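(* Let $q_1(x),q_2(x)$ be the minimizers of the optimal control problem (minimize $J_g$ over $\mathcal A$) corresponding to $g=g_1(x)$ and $g=g_2(x)$, respectively. If there exists a point $x_0\in(0,l)$ such that $$q_1(x_0)=q_2(x_0),$$ then for relatively small $T$ we have $$\max_{x\in(0,l)}|q_1-q_2|\le\frac{C\,l^{1/3}}{N^{1/3}}\,\|g_1-g_2\|_{L^2(0,l)},$$ where the constant $C$ is independent of $T$, $l$ and $N$.
   Context: Let $l,T>0$, $Q=(0,l)\times(0,T]$, and let $\nabla$ denote $\partial/\partial x$. Assumptions on the given data: $a\in C^1[0,l]$, $a(0)=a(l)=0$, $a(x)>0$ for $x\in(0,l)$; $\phi$ is a given smooth function with $\phi\ge0$, $\phi\not\equiv0$ on $(0,l)$; $g_1,g_2\in L^\infty(0,l)$ are two given functions; $N$ is the (positive) regularization parameter; $\alpha,\beta$ are two given positive constants. The admissible set and, for $g\in L^\infty(0,l)$, the cost functional are $$\mathcal A=\{q:\ 0<\alpha\le q\le\beta,\ \|q\|_{H^1(0,l)}<\infty\},\qquad J_g(q)=\frac12\int_0^l|u(x,T;q)-g(x)|^2dx+\frac N2\int_0^l|\nabla q|^2dx.$$ $\mathscr H^1(0,l)$ is the closure of $C_0^\infty(0,l)$ under the norm $\|v\|_{\mathscr H^1}^2=\int_0^l a(x)(|v|^2+|\nabla v|^2)\,dx$. For $q\in\mathcal A$, $u(\cdot,\cdot;q)$ is the (unique) weak solution of $u_t-(au_x)_x+qu=0$ in $Q$, $u|_{t=0}=\phi$ (no boundary condition at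 $x=0,l$), that is: $u\in H^1((0,T);L^2(0,l))\cap L^2((0,T);\mathscr H^1(0,l))$, $u(x,0)=\phi(x)$, and for a.e. $t\in(0,T]$ $$\int_0^l u_t\psi\,dx+\int_0^l a\nabla u\cdot\nabla\psi\,dx+\int_0^l qu\psi\,dx=0\qquad\forall\psi\in L^2(0,l)\cap\mathscr H^1(0,l).$$ *)

(* Defs.v *)
From HB Require Import structures.
From mathcomp Require Import all_boot all_order all_algebra.
From mathcomp Require Import all_classical all_reals all_analysis.
Import Order.TTheory GRing.Theory Num.Theory.
Import numFieldNormedType.Exports.

Set Implicit Arguments.
Unset Strict Implicit.
Unset Printing Implicit Defensive.

Local Open Scope ring_scope.
Local Open Scope classical_set_scope.

Section function_spaces.
Context {R : realType}.
Implicit Types (a v w f g phi psi eta q : R -> R) (u ut ux : R -> R -> R).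

Local Notation mu := (@lebesgue_measure R).

(* Only the values on ]0, l[ matter: functions are cut off outside of it. *)
Definition inL2 (l : R) f : Prop := f \_ `]0, l[ \in Lfun mu 2%:E.

Definition L2norm (l : R) f : R := fine 'N[mu]_2%:E [EFin \o (f \_ `]0, l[)].

Definition inLinfty (l : R) f : Prop := f \_ `]0, l[ \in Lfun mu +oo%E.

Definition Linfty_norm (l : R) f : \bar R :=
  'N[mu]_(+oo%E) [EFin \o (f \_ `]0, l[)].

Definition smooth_on (D : set R) f : Prop :=
  forall n x, D x -> derivable (derive1n n f) x 1.

Definition C0infty (b : R) psi : Prop :=
  [/\ smooth_on setT psi,
      compact (closure [set x | psi x != 0]) &
      closure [set x | psi x != 0] `<=` `]0, b[].

(* C^1 up to the end points: the derivative on ]0, l[ extends continuously. *)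
Definition C1_closed (l : R) a : Prop :=
  {within `[0, l], continuous a} /\
  exists2 da : R -> R, {within `[0, l], continuous da} &
    forall x, `]0, l[ x -> is_derive x 1 a (da x).

Definition is_weak_grad (l : R) v w : Prop :=
  [/\ locally_integrable `]0, l[ v,
      locally_integrable `]0, l[ w &
      forall psi, C0infty l psi ->
        \int[mu]_(x in `]0, l[) (v x * derive1 psi x) =
        - \int[mu]_(x in `]0, l[) (w x * psi x)].

(* A chosen weak gradient; it is unique almost everywhere on ]0, l[. *)
Definition weak_grad (l : R) v : R -> R :=
  xget (fun=> 0) [set w | is_weak_grad l v w].

Definition inH1 (l : R) v : Prop :=
  inL2 l v /\ exists2 w, is_weak_grad l v w & inL2 l w.

(* v lies in the closure of C_0^oo(0, l) for the weighted norm
   (\int a (|v|^2 + |v'|^2))^(1/2), and w is its gradient. *)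
Definition inH1a (a : R -> R) (l : R) v w : Prop :=
  is_weak_grad l v w /\
  forall e : R, 0 < e -> exists2 psi, C0infty l psi &
    (\int[mu]_(x in `]0%R, l[)
       (a x * ((v x - psi x) ^+ 2 + (w x - derive1 psi x) ^+ 2))%:E < e%:E)%E.

(* Space-time functions are curried, time first: u t x stands for u(x, t). *)
Definition cylinder (l T : R) : set (R * R) := `]0, T[ `*` `]0, l[.

Definition inL2Q (l T : R) u : Prop :=
  (fun z : R * R => u z.1 z.2) \_ (cylinder l T) \in Lfun (mu \x mu)%E 2%:E.

(* u is in H^1((0, T); L^2(0, l)) with weak time derivative ut.  An element of
   this space has a unique representative in C([0, T]; L^2(0, l)), and u is
   required to be it, so that u 0 and u T are its traces. *)
Definition inH1L2 (l T : R) u ut : Prop :=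
  [/\ inL2Q l T u,
      inL2Q l T ut,
      forall eta, C0infty T eta ->
        {ae mu, forall x, `]0, l[ x ->
          \int[mu]_(t in `]0, T[) (u t x * derive1 eta t) =
          - \int[mu]_(t in `]0, T[) (ut t x * eta t)},
      forall t, `[0, T] t -> inL2 l (u t) &
      forall s, `[0, T] s ->
        L2norm l (fun x => u t x - u s x) @[t --> within `[0, T] (nbhs s)]
          --> (0 : R)].

(* u is in L^2((0, T); H) with spatial gradient ux, H the weighted space. *)
Definition inL2H1a (a : R -> R) (l T : R) u ux : Prop :=
  [/\ measurable_fun (cylinder l T) (fun z : R * R => u z.1 z.2),
      measurable_fun (cylinder l T) (fun z : R * R => ux z.1 z.2),
      {ae mu, forall t, `]0, T[ t -> inH1a a l (u t) (ux t)} &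
      (\int[mu \x mu]_(z in cylinder l T)
         (a z.2 * (u z.1 z.2 ^+ 2 + ux z.1 z.2 ^+ 2))%:E < +oo)%E].

Definition weak_solution (a phi : R -> R) (l T : R) q u : Prop :=
  exists ut ux : R -> R -> R,
    [/\ inH1L2 l T u ut,
        inL2H1a a l T u ux,
        {ae mu, forall x, `]0, l[ x -> u 0 x = phi x} &
        {ae mu, forall t, `]0, T] t ->
          forall psi dpsi : R -> R, inL2 l psi -> inH1a a l psi dpsi ->
            \int[mu]_(x in `]0, l[) (ut t x * psi x)
            + \int[mu]_(x in `]0, l[) (a x * ux t x * dpsi x)
            + \int[mu]_(x in `]0, l[) (q x * u t x * psi x) = 0}].

(* Elements of H^1(0, l) are identified with their continuous representative,
   which gives a meaning to pointwise values of q. *)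
Definition admissible (alpha beta l : R) q : Prop :=
  [/\ forall x, `]0, l[ x -> alpha <= q x <= beta,
      {in `]0, l[, continuous q} &
      inH1 l q].

(* usol q is the state u(., .; q). *)
Definition cost (l T N : R) (usol : (R -> R) -> R -> R -> R) g q : R :=
  2^-1 * \int[mu]_(x in `]0, l[) (`|usol q T x - g x| ^+ 2)
  + N / 2 * \int[mu]_(x in `]0, l[) (`|weak_grad l q x| ^+ 2).

Definition is_minimizer (alpha beta l T N : R)
    (usol : (R -> R) -> R -> R -> R) g q : Prop :=
  admissible alpha beta l q /\
  forall p, admissible alpha beta l p -> cost l T N usol g q <= cost l T N usol g p.

End function_spaces.

(* Main.v *)
Require Import Defs.
From mathcomp Require Import all_boot all_order all_algebra.
From mathcomp Require Import all_classical all_reals all_analysis.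
From mathcomp Require Import measurable_realfun ess_sup_inf ring lra.
Import Order.TTheory GRing.Theory Num.Theory.
Import numFieldNormedType.Exports.

Local Open Scope ring_scope.
Local Open Scope classical_set_scope.

(** Compare both minimizers with the midpoint p = (q1 + q2)/2, which is
    admissible.  Write u1, u2, um for the states of q1, q2, p at time T, and put
    d = u1 - u2 and v = um - (u1 + u2)/2.  Adding J_g1(q1) <= J_g1(p) and
    J_g2(q2) <= J_g2(p) and using the parallelogram law on the gradients gives
      N |q1' - q2'|^2 <= 4 <v, um + (u1 + u2)/2 - g1 - g2> + 2 <d, g1 - g2>.
    As q1 - q2 vanishes at x0, |q1 - q2| <= k with k^2 = l |q1' - q2'|^2.  The
    source term in the equation of d is (q1 - q2) u2, and that in the equation of
    v is (q1 - q2) d / 4, so the energy inequality gives |d| = O(k T) and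
    |v| = O(k^2 T^2).  The first term on the right is therefore O(T^2) k^2, which
    is absorbed by the left-hand side for small T; so is the part of the second
    one that is left by Young's inequality with weight of order (l/N)^(1/3), and
    there remains k <= (l/N)^(1/3) |g1 - g2|. *)

Set Implicit Arguments.
Unset Strict Implicit.
Unset Printing Implicit Defensive.

(** * Smooth cut-off functions *)

(** The midpoint takes the place of a first-order optimality condition: minimality is tested at one
    further point, and the admissible set is convex. The price is [v], the defect of linearity of
    the map from q to its state. The argument rests on its being of second order in k: a bound |v| =
    O(k T) would leave a term linear in k, which k^2 cannot absorb. The cube root comes from a
    balance. Young's inequality with weight 2 rho leaves k^2 <= (l/N) |g1 - g2|^2 / rho, and rho^3 =
    l/N turns the right-hand side into rho^2 |g1 - g2|^2. Whatever the weight multiplies is charged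
    to the smallness of T, so that C = 1 and T0 depends on l, N and M. Most of the work lies in the
    energy inequality. The weak time derivative is given through test functions of t at almost every
    x, which says nothing directly about |u(t)|^2. The pairing of u(t) with a fixed g is a scalar
    function with an integrable weak derivative; the square norm is reached from such pairings by
    subdividing time. *)

Section bump.
Context {R : realType}.
Implicit Types (p q : {poly R}) (x y : R).

(** The classical flat function e^(-1/x), with a polynomial factor in 1/x so that the family is
    stable under differentiation: p becomes X^2 (p - p'). *)
Definition flat p x : R := if 0 < x then p.[x^-1] * expR (- x^-1) else 0.

(** The exponent n carries the induction on p: a factor X of p moves into y^n, and a constant
    coefficient is controlled by y^n <= n! e^y. *)
Lemma poly_expRN_bounded p n :
  exists C : R, forall y, 0 < y -> `|p.[y] * y ^+ n * expR (- y)| <= C.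
Proof.
elim/poly_ind: p n => [|p c IH] n.
  by exists 0 => y _; rewrite horner0 !mul0r normr0.
have [C1 H1] := IH n.+1.
exists (C1 + `|c| * (n.+1)`!%:R) => y y0.
rewrite hornerMXaddC !mulrDl -(mulrA _ y) -exprS.
apply: (le_trans (ler_normD _ _)); apply: lerD; first exact: H1.
rewrite -mulrA normrM; apply: ler_wpM2l => //.
rewrite ger0_norm ?mulr_ge0 ?exprn_ge0 ?expR_ge0 ?(ltW y0)// expRN.
rewrite ler_pdivrMr ?expR_gt0//.
case: n {H1} => [|n].
  rewrite expr0 factS mul1n fact0 mul1r.
  by rewrite -expR0 ler_expR ltW.
have := expR_ge1Dxn n (ltW y0); set e := expR y => he.
have f0 : (0 : R) < n.+1`!%:R by rewrite ltr0n fact_gt0.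
have : y ^+ n.+1 <= n.+1`!%:R * e.
  rewrite mulrC -ler_pdivrMr//; lra.
move=> /le_trans; apply; rewrite ler_pM2r ?expR_gt0// ler_nat.
by rewrite [leqRHS]factS leq_pmull.
Qed.

Lemma is_derive_flat p x :
  is_derive x 1 (flat p) (flat ('X^2 * (p - p^`())) x).
Proof.
have [x0|x0|x0] := ltgtP 0 x.
- have : is_derive x 1 (fun y => p.[y^-1] * expR (- y^-1))
      (flat ('X^2 * (p - p^`())) x).
    have xn0 : x != 0 by rewrite gt_eqF.
    have dV : is_derive x 1 (fun y : R => y^-1) (- x ^- 2).
      have := @is_deriveV R id x 1 1 xn0 _.
      by rewrite /GRing.scale/= mulr1; apply.
    have dp : is_derive x 1 (fun y : R => p.[y^-1]) (p^`().[x^-1] * (- x ^- 2)).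
      exact: (@is_derive1_comp R (horner p) _ x _ _ (is_derive_poly _ _) dV).
    have de : is_derive x 1 (fun y : R => expR (- y^-1))
        (expR (- x^-1) * (x ^- 2)).
      apply: (@is_derive1_comp R expR _ x _ _ (is_derive_expR _)).
      by rewrite -[x ^- 2]opprK; exact: is_deriveN.
    apply: is_derive_eq.
    rewrite /flat x0 /GRing.scale/= hornerM hornerXn hornerD hornerN -!exprVn; ring.
  apply: near_eq_is_derive => //.
  near=> y; rewrite /flat ifT//; near: y.
  exact: lt_nbhsr.
- have : is_derive x 1 (cst 0 : R -> R) (flat ('X^2 * (p - p^`())) x).
    by rewrite /flat ltNge (ltW x0)/=; exact: is_derive_cst.
  apply: near_eq_is_derive => //.
  near=> y; rewrite /flat ifF//; apply/negbTE; rewrite -leNgt ltW//; near: y.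
  exact: lt_nbhsl.
- rewrite -x0 /flat ltxx.
  suff H : h^-1 *: (flat p (h *: 1 + 0) - flat p 0) @[h --> 0^'] --> (0 : R).
    apply: DeriveDef; first by apply/cvg_ex; exists 0; exact: H.
    by apply/cvg_lim; [exact: Rhausdorff|exact: H].
  (* For h > 0 the quotient is h times p(1/h) h^(-2) e^(-1/h), and the second factor stays
     bounded. *)
  have [C HC] := poly_expRN_bounded p 2.
  apply/cvgrPdist_le => e e0.
  have C0 : 0 <= C by apply: le_trans (HC 1 ltr01).
  near=> h.
  rewrite sub0r normrN {2}/flat ltxx subr0 addr0 /GRing.scale/= mulr1.
  rewrite /flat; case: ifPn => h0; last by rewrite mulr0 normr0 ltW.
  have := HC h^-1; rewrite invr_gt0 => /(_ h0) Hh.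
  apply: (@le_trans _ _ (h * C)).
    rewrite (_ : h^-1 * _ = h * (p.[h^-1] * h^-1 ^+ 2 * expR (- h^-1))).
      by rewrite normrM (gtr0_norm h0) ler_wpM2l// ltW.
    have hn0 : h != 0 by rewrite gt_eqF.
    by field.
  apply: (@le_trans _ _ (h * (C + 1))); first by rewrite ler_wpM2l ?(ltW h0)// lerDl.
  rewrite -ler_pdivlMr; last by rewrite ltr_wpDl.
  rewrite -(gtr0_norm h0); near: h.
  apply: dnbhs0_le; apply: divr_gt0 => //; by rewrite ltr_wpDl.
Unshelve. all: by end_near. Qed.

(** A class stable under differentiation, so that each member is smooth without computing higher
    derivatives. [Bump_primitive] admits the antiderivative of a bump, from which the cut-offs are
    built. *)
Inductive bump_class : (R -> R) -> Prop :=
| Bump_base p q (a c : R) :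
    bump_class (fun x => flat p (a * x + c) * flat q (1 - (a * x + c)))
| Bump_add f g : bump_class f -> bump_class g -> bump_class (fun x => f x + g x)
| Bump_primitive f g : bump_class g -> (forall x, is_derive x 1 f (g x)) ->
    bump_class f.

Lemma bump_class_derive f : bump_class f ->
  exists2 g, bump_class g & forall x, is_derive x 1 f (g x).
Proof.
elim=> {f} [p q a c|f g _ [f' Hf' df] _ [g' Hg' dg]|f g Hg _ df].
- exists (fun x => flat ((a%:P * ('X^2 * (p - p^`())))) (a * x + c) *
                   flat q (1 - (a * x + c)) +
    flat p (a * x + c) *
      flat ((- a)%:P * ('X^2 * (q - q^`()))) (1 - (a * x + c))).
    by apply: Bump_add; exact: Bump_base.
  move=> x.
  have da : is_derive x 1 (fun x => a * x + c) a.
    apply: is_derive_eq; rewrite /GRing.scale/=; ring.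
  have da' : is_derive x 1 (fun x => 1 - (a * x + c)) (- a).
    apply: is_derive_eq; rewrite /GRing.scale/=; ring.
  have d1 := @is_derive1_comp R (flat p) _ x _ _ (is_derive_flat _ _) da.
  have d2 := @is_derive1_comp R (flat q) _ x _ _ (is_derive_flat _ _) da'.
  have flatZ (k : R) (r : {poly R}) y : flat (k%:P * r) y = k * flat r y.
    by rewrite /flat; case: ifP; rewrite ?mulr0// hornerM hornerC mulrA.
  rewrite !flatZ.
  have := @is_deriveM _ _ _ _ _ _ _ _ d1 d2.
  rewrite /GRing.scale/= => D; apply: (is_derive_eq D).
  rewrite /=; ring.
- exists (fun x => f' x + g' x); first exact: Bump_add.
  by move=> x; apply: is_deriveD.
- by exists g.
Qed.

Lemma bump_class_smooth f : bump_class f -> smooth_on setT f.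
Proof.
move=> Hf n x _.
suff : bump_class (derive1n n f).
  by move=> /bump_class_derive[g _ /(_ x)[]].
elim: n => // n /bump_class_derive[g Hg dg].
rewrite derive1nS; suff -> : (derive1n n f)^`() = g by [].
by apply/funext => y; rewrite derive1E; exact: derive_val.
Qed.

End bump.

Section cutoff.
Context {R : realType}.
Local Notation mu := (@lebesgue_measure R).
Implicit Types (x y r s t k b : R).

Definition bump x : R := flat 1 x * flat 1 (1 - x).

Lemma bump_ge0 x : 0 <= bump x.
Proof.
rewrite /bump /flat; case: ifP => _; case: ifP => _;
by rewrite ?mul0r ?mulr0// !hornerC !mul1r mulr_ge0 ?expR_ge0.
Qed.

Lemma bump_gt0 x : 0 < x < 1 -> 0 < bump x.
Proof.
move=> /andP[x0 x1]; rewrite /bump /flat x0 subr_gt0 x1 !hornerC !mul1r.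
by rewrite mulr_gt0 ?expR_gt0.
Qed.

Lemma bump_le0 x : x <= 0 -> bump x = 0.
Proof. by move=> x0; rewrite /bump {1}/flat ltNge x0 mul0r. Qed.

Lemma bump_ge1 x : 1 <= x -> bump x = 0.
Proof. by move=> x1; rewrite /bump {2}/flat subr_gt0 ltNge x1 mulr0. Qed.

Lemma is_derive_continuous (f : R -> R) (g : R -> R) :
  (forall x, is_derive x 1 f (g x)) -> continuous f.
Proof. by move=> df x; apply/differentiable_continuous/derivable1_diffP. Qed.

Lemma bump_class_bump k c : bump_class (fun x => bump (k * x + c)).
Proof. exact: Bump_base. Qed.

Lemma bump_continuous : continuous bump.
Proof.
have := bump_class_bump 1 0; under eq_fun do rewrite mul1r addr0.
by move=> /bump_class_derive[g _]; exact: is_derive_continuous.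
Qed.

(** A smooth step from 0 to the total mass [step 1] of the bump. The mass is not normalized; it is
    divided out once, at the end of [weak_derivative_FTC]. *)
Definition step y := \int[mu]_(x in `]-oo, y]) bump x.

Lemma bump_integrable : mu.-integrable setT (EFin \o bump).
Proof.
have -> : EFin \o bump = (EFin \o bump) \_ `[0, 1].
  apply/funext => x; rewrite patchE; case: ifPn => // /negP xn /=.
  have [x0|x0] := leP x 0; first by rewrite bump_le0.
  have [x1|x1] := leP 1 x; first by rewrite bump_ge1.
  by exfalso; apply: xn; rewrite inE/= in_itv/= !ltW.
apply/(integrable_mkcond _ _).1 => //.
apply: continuous_compact_integrable; first exact: segment_compact.
exact/continuous_subspaceT/bump_continuous.
Qed.

Lemma is_derive_step y : is_derive y 1 step (bump y).
Proof.
have [] := @continuous_FTC1 R bump -oo%O y (y + 1) _ _ _ _.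
- by rewrite ltrDl.
- by apply: integrableS bump_integrable.
- exact: ltNyr.
- exact: bump_continuous.
move=> d e; split; first exact: d.
by move: e; rewrite derive1E.
Qed.

Lemma step_le0 y : y <= 0 -> step y = 0.
Proof.
move=> y0; rewrite /step (@eq_Rintegral _ _ _ _ _ (cst 0)).
  by rewrite /Rintegral integral0.
move=> x; rewrite inE/= in_itv/= => xy; apply: bump_le0; exact: le_trans xy y0.
Qed.

Lemma step_ge1 y : 1 <= y -> step y = step 1.
Proof.
move=> y1; rewrite /step Rintegral_mkcond [RHS]Rintegral_mkcond.
congr Rintegral; apply/funext => x; rewrite !patchE !mem_setE !in_itv/=.
have [x1|x1] := leP x 1; first by rewrite (le_trans x1).
by rewrite bump_ge1 ?(ltW x1)//; case: ifP.
Qed.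

Lemma step_ge0 y : 0 <= step y.
Proof. by apply: Rintegral_ge0 => x _; exact: bump_ge0. Qed.

Lemma step_le y : step y <= step 1.
Proof.
have [y1|/ltW y1] := leP 1 y; first by rewrite step_ge1.
apply: (@ger0_derive1_le_cc R step y 1) => //.
- by move=> x _; have [] := is_derive_step x.
- move=> x _; rewrite derive1E; have [_ ->] := is_derive_step x.
  exact: bump_ge0.
- exact/continuous_subspaceT/(is_derive_continuous is_derive_step).
- by rewrite in_itv/= lexx.
- by rewrite in_itv/= lexx y1.
Qed.

Lemma step1_gt0 : 0 < step 1.
Proof.
rewrite -(step_le0 (lexx 0)); apply: (@gtr0_derive1_lt_cc R step 0 1) => //.
- by move=> x _; have [] := is_derive_step x.
- move=> x; rewrite in_itv/= => x01; rewrite derive1E.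
  by have [_ ->] := is_derive_step x; exact: bump_gt0.
- exact/continuous_subspaceT/(is_derive_continuous is_derive_step).
- by rewrite in_itv/= lexx ler01.
- by rewrite in_itv/= lexx ler01.
Qed.

(* Equal to [step 1] on [s + 2/k, t - 2/k] and to 0 outside [s + 1/k, t - 1/k]. *)
Definition cutoff k s t r : R :=
  step (k * (r - s) - 1) + step (k * (t - r) - 1) - step 1.

(** For large k, an approximate Dirac mass just to the right of [s] minus one just to the left of
    [t], each of mass [step 1]. *)
Definition dcutoff k s t r : R :=
  k * bump (k * (r - s) - 1) - k * bump (k * (t - r) - 1).

Lemma is_derive_step_affine k c r :
  is_derive r 1 (fun r => step (k * r + c)) (k * bump (k * r + c)).
Proof.
have da : is_derive r 1 (fun x => k * x + c) k.
  by apply: is_derive_eq; rewrite /GRing.scale/=; ring.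
rewrite mulrC; exact: (@is_derive1_comp R step _ r _ _ (is_derive_step _) da).
Qed.

Lemma affineL k s r : k * (r - s) - 1 = k * r + (- k * s - 1).
Proof. ring. Qed.

Lemma affineR k t r : k * (t - r) - 1 = (- k) * r + (k * t - 1).
Proof. ring. Qed.

Lemma is_derive_cutoff k s t r : is_derive r 1 (cutoff k s t) (dcutoff k s t r).
Proof.
rewrite /cutoff /dcutoff.
under eq_fun do rewrite affineL affineR.
rewrite affineL affineR -mulNr.
have d1 := is_derive_step_affine k (- k * s - 1) r.
have d2 := is_derive_step_affine (- k) (k * t - 1) r.
by apply: is_derive_eq; rewrite subr0.
Qed.

Lemma derive1_cutoff k s t : derive1 (cutoff k s t) = dcutoff k s t.
Proof.
by apply/funext => r; rewrite derive1E; have [_ ->] := is_derive_cutoff k s t r.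
Qed.

Lemma bump_classZ k f : bump_class f -> bump_class (fun x : R => k * f x).
Proof.
elim=> {f} [p q a c|f g _ IHf _ IHg|f g _ IH df].
- have -> : (fun x => k * (flat p (a * x + c) * flat q (1 - (a * x + c)))) =
      (fun x => flat (k%:P * p) (a * x + c) * flat q (1 - (a * x + c))).
    apply/funext => x; rewrite mulrA; congr (_ * _).
    by rewrite /flat; case: ifP; rewrite ?mulr0// hornerM hornerC mulrA.
  exact: Bump_base.
- under eq_fun do rewrite mulrDr; exact: Bump_add.
- exact: Bump_primitive IH _.
Qed.

Lemma cutoff_smooth k s t : smooth_on setT (cutoff k s t).
Proof.
apply/bump_class_smooth.
apply: (Bump_primitive (g := dcutoff k s t)); last exact: is_derive_cutoff.
rewrite /dcutoff; under eq_fun do rewrite -mulNr affineL affineR.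
by apply: Bump_add; apply: bump_classZ; exact: bump_class_bump.
Qed.

(** The condition k (t - s) >= 4 keeps the two ramps from overlapping: at every point at least one
    of the two steps has reached [step 1]. *)
Lemma cutoff_eq0 k s t r : 4 <= k * (t - s) ->
  k * (r - s) <= 1 \/ k * (t - r) <= 1 -> cutoff k s t r = 0.
Proof.
have kE : k * (t - s) = k * (r - s) + k * (t - r) by ring.
rewrite kE /cutoff => k4 [h|h].
  by rewrite step_le0 ?step_ge1 ?add0r ?subrr//; lra.
by rewrite [X in _ + X - _]step_le0 ?step_ge1 ?addr0 ?subrr//; lra.
Qed.

Lemma cutoff_eq k s t r :
  2 <= k * (r - s) -> 2 <= k * (t - r) -> cutoff k s t r = step 1.
Proof.
move=> h1 h2; rewrite /cutoff step_ge1; last lra.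
rewrite step_ge1; [ring|lra].
Qed.

Lemma cutoff_bound k s t r : 4 <= k * (t - s) ->
  0 <= cutoff k s t r <= step 1.
Proof.
have kE : k * (t - s) = k * (r - s) + k * (t - r) by ring.
rewrite kE /cutoff => k4.
have := step_ge0 (k * (r - s) - 1); have := step_le (k * (r - s) - 1).
have := step_ge0 (k * (t - r) - 1); have := step_le (k * (t - r) - 1).
have [h|h] := leP 2 (k * (r - s)).
  rewrite (@step_ge1 (k * (r - s) - 1)); lra.
rewrite (@step_ge1 (k * (t - r) - 1)); lra.
Qed.

Lemma cutoff_continuous k s t : continuous (cutoff k s t).
Proof. exact: is_derive_continuous (is_derive_cutoff k s t). Qed.

Lemma cutoff_C0infty b k s t : 0 <= s -> t <= b -> 4 <= k * (t - s) -> 0 < k ->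
  C0infty b (cutoff k s t).
Proof.
move=> s0 tb k4 k0.
have sub : closure [set x | cutoff k s t x != 0] `<=` `[s + k^-1, t - k^-1].
  have <- : closure `[s + k^-1, t - k^-1] = `[s + k^-1, t - k^-1].
    by apply/esym/closure_id; exact: interval_closed.
  apply: closure_subset => x /= /eqP xn; rewrite in_itv/=; apply/andP; split.
    rewrite leNgt; apply/negP => xs; apply: xn; apply: cutoff_eq0 => //; left.
    by rewrite -ler_pdivlMl// mulr1 lerBlDl ltW.
  rewrite leNgt; apply/negP => xs; apply: xn; apply: cutoff_eq0 => //; right.
  by rewrite -ler_pdivlMl// mulr1; move: xs; lra.
split; first exact: cutoff_smooth.
- apply: subclosed_compact sub; first exact: closed_closure.
  exact: segment_compact.
- move=> x /sub; rewrite /= !in_itv/=.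
  have : 0 < k^-1 by rewrite invr_gt0.
  lra.
Qed.

End cutoff.

(** * Fundamental theorem of calculus for weak derivatives *)

Section weak_derivative_FTC.
Context {R : realType}.
Local Notation mu := (@lebesgue_measure R).

Lemma Rintegral_support d (X : measurableType d)
    (m : {measure set X -> \bar R}) (D E : set X) (f : X -> R) :
  (forall x, D x -> ~ E x -> f x = 0) -> (forall x, E x -> ~ D x -> f x = 0) ->
  \int[m]_(x in D) f x = \int[m]_(x in E) f x.
Proof.
move=> DE ED; rewrite Rintegral_mkcond [RHS]Rintegral_mkcond.
congr Rintegral; apply/funext => x; rewrite !patchE.
case: ifPn => [/set_mem Dx|/negP Dx]; case: ifPn => [/set_mem Ex|/negP Ex] //.
- by apply: DE => // Ex'; apply: Ex; exact/mem_set.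
- by apply/esym/ED => // Dx'; apply: Dx; exact/mem_set.
Qed.

Lemma integrable_scale d (X : measurableType d)
    (m : {measure set X -> \bar R}) (D : set X) (c : R) (f : X -> R) :
  measurable D -> m.-integrable D (EFin \o f) ->
  m.-integrable D (EFin \o (fun x => c * f x)).
Proof. by move=> mD; exact: (@integrableZl _ _ _ m _ mD c (EFin \o f)). Qed.

Lemma integrable_add d (X : measurableType d)
    (m : {measure set X -> \bar R}) (D : set X) (f g : X -> R) :
  measurable D -> m.-integrable D (EFin \o f) -> m.-integrable D (EFin \o g) ->
  m.-integrable D (EFin \o (fun x => f x + g x)).
Proof. by move=> mD; exact: (@integrableD _ _ _ m _ mD (EFin \o f) (EFin \o g)). Qed.

Lemma integrable_sub d (X : measurableType d)
    (m : {measure set X -> \bar R}) (D : set X) (f g : X -> R) :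
  measurable D -> m.-integrable D (EFin \o f) -> m.-integrable D (EFin \o g) ->
  m.-integrable D (EFin \o (fun x => f x - g x)).
Proof. by move=> mD; exact: (@integrableB _ _ _ m _ mD (EFin \o f) (EFin \o g)). Qed.

Lemma continuous_integrable_itv (s t : R) (f : R -> R) :
  {within `[s, t], continuous f} -> mu.-integrable `[s, t] (EFin \o f).
Proof. by apply: continuous_compact_integrable; exact: segment_compact. Qed.

Lemma Rintegral_derive (s t : R) (f F : R -> R) : s < t ->
  continuous f -> (forall x : R, is_derive x 1 F (f x)) ->
  \int[mu]_(x in `[s, t]) f x = F t - F s.
Proof.
move=> st cf dF; rewrite /Rintegral (@continuous_FTC2 R f F s t)//.
- exact: continuous_subspaceT.
- have cF : continuous F := is_derive_continuous dF.
  split.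
  + by move=> x _; have [] := dF x.
  + apply: cvg_at_right_filter; exact: cF.
  + apply: cvg_at_left_filter; exact: cF.
- by move=> x _; rewrite derive1E; have [_] := dF x.
Qed.

(* [rho] is an approximate Dirac mass, of total mass [m]. *)
Lemma Rintegral_approx (s t c e m : R) (y rho : R -> R) :
  {within `[s, t], continuous y} -> continuous rho ->
  (forall x, 0 <= rho x) -> \int[mu]_(x in `[s, t]) rho x = m ->
  (forall x, `[s, t] x -> rho x != 0 -> `|y x - c| <= e) ->
  `|\int[mu]_(x in `[s, t]) (y x * rho x) - m * c| <= e * m.
Proof.
move=> cy crho rho0 rhom ye.
have crho' : {within `[s, t], continuous rho} by exact: continuous_subspaceT.
have iyr : mu.-integrable `[s, t] (EFin \o (fun x => y x * rho x)).
  apply: continuous_integrable_itv => x.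
  by apply: (@continuousM _ (subspace `[s, t])); [exact: cy|exact: crho'].
have ir := continuous_integrable_itv crho'.
have irc : mu.-integrable `[s, t] (EFin \o (fun x => rho x * c)).
  rewrite (_ : (fun x => rho x * c) = (fun x => c * rho x)).
    exact: integrable_scale.
  by apply/funext => x; rewrite mulrC.
have mst : measurable (`[s, t]%classic : set R) by exact: measurable_itv.
rewrite -rhom -RintegralZr// -RintegralB//.
apply: (le_trans (le_normr_Rintegral _ _)) => //.
  exact: integrable_sub.
rewrite -RintegralZl//; apply: le_Rintegral => //.
- by apply: integrable_norm; exact: integrable_sub.
- exact: integrable_scale.
move=> x xst; rewrite (mulrC (rho x)) -mulrBl normrM (ger0_norm (rho0 x)).
have [->|rx] := eqVneq (rho x) 0; first by rewrite !mulr0.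
by rewrite ler_wpM2r// ye.
Qed.

(** The hypotheses are local to [s, t], because the result serves twice: for scalar functions of
    time, up to the end points 0 and T, and for coefficients in space, whose weak gradient is only
    locally integrable on ]0, l[. *)
Variables (b s t : R) (y h : R -> R).
Hypotheses (s0 : 0 <= s) (st : s < t) (tb : t <= b).
Hypothesis cy : {within `[s, t], continuous y}.
Hypothesis ih : mu.-integrable `]s, t[ (EFin \o h).
Hypothesis weak : forall eta, C0infty b eta ->
  (forall x, ~ `]s, t[ x -> eta x = 0) ->
  \int[mu]_(x in `]0, b[) (y x * derive1 eta x) =
  - \int[mu]_(x in `]0, b[) (h x * eta x).

(** The shift gives k_n (t - s) >= 4 already for n = 0. *)
Let k (n : nat) : R := n%:R + (4 / (t - s) + 1).

Let k_gt0 n : 0 < k n.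
Proof. by rewrite ltr_wpDl// ltr_wpDl// divr_ge0// subr_ge0 ltW. Qed.

Let k_ge n : 4 <= k n * (t - s).
Proof.
rewrite -ler_pdivrMr ?subr_gt0// /k.
have : (0 : R) <= n%:R by []. lra.
Qed.

Let k_cvg (e : R) : 0 < e -> \forall n \near \oo, 2 <= k n * e.
Proof.
move=> e0; near=> n; rewrite -ler_pdivrMr//.
apply: (@le_trans _ _ n%:R); first by near: n; exact: nbhs_infty_ger.
rewrite /k lerDl addr_ge0// divr_ge0// subr_ge0 ltW//.
Unshelve. all: by end_near. Qed.

Let itvS : `]s, t[ `<=` `]0, b[.
Proof. by apply: subset_itv; rewrite bnd_simp. Qed.

Let weak_cutoff n :
  \int[mu]_(x in `[s, t]) (y x * dcutoff (k n) s t x) =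
  - \int[mu]_(x in `]s, t[) (h x * cutoff (k n) s t x).
Proof.
have out x : ~ `]s, t[ x -> k n * (x - s) <= 0 \/ k n * (t - x) <= 0.
  move=> /negP; rewrite in_itv/= negb_and -!leNgt => /orP[xs|tx].
    by left; rewrite pmulr_rle0// subr_le0.
  by right; rewrite pmulr_rle0// subr_le0.
have c0 x : ~ `]s, t[ x -> cutoff (k n) s t x = 0.
  move=> /out xst; apply: cutoff_eq0 => //.
  by case: xst => ?; [left|right]; lra.
have d0 x : ~ `]s, t[ x -> dcutoff (k n) s t x = 0.
  move=> /out xst; rewrite /dcutoff.
  have := k_ge n; have -> : k n * (t - s) = k n * (x - s) + k n * (t - x) by ring.
  move=> h4; case: xst => hx.
    by rewrite bump_le0 ?bump_ge1 ?mulr0 ?subrr//; lra.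
  by rewrite [X in _ - _ * X]bump_le0 ?bump_ge1 ?mulr0 ?subrr//; lra.
have := weak (cutoff_C0infty s0 tb (k_ge n) (k_gt0 n)) c0.
rewrite derive1_cutoff => E.
rewrite -(@Rintegral_support _ _ mu `]0, b[ `]s, t[); last 2 first.
- by move=> x _ /c0 ->; rewrite mulr0.
- by move=> x /itvS.
rewrite -E; apply: Rintegral_support.
- move=> x xst x0b; rewrite d0 ?mulr0// => /itvS; exact: x0b.
- move=> x _ xst; rewrite d0 ?mulr0// => /subset_itv_oo_cc; exact: xst.
Qed.

(** The two halves of [dcutoff] concentrate at s and t, where the continuity of y up to the end
    points picks out its values. *)
Let cvg_lhs : (\int[mu]_(x in `[s, t]) (y x * dcutoff (k n) s t x)) @[n --> \oo]
  --> (step 1 * y s - step 1 * y t : R).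
Proof.
have cbump kk c : continuous (fun x : R => bump (kk * x + c)).
  move=> x; apply: (@continuous_comp _ _ _ (fun x => kk * x + c) bump).
    by apply: cvgD; [apply: cvgM; [exact: cvg_cst|exact: cvg_id]|exact: cvg_cst].
  exact: bump_continuous.
pose r1 n x := k n * bump (k n * (x - s) - 1).
pose r2 n x := k n * bump (k n * (t - x) - 1).
have cr1 n : continuous (r1 n).
  rewrite /r1; under eq_fun do rewrite affineL.
  by move=> x; apply: cvgM; [exact: cvg_cst|exact: cbump].
have cr2 n : continuous (r2 n).
  rewrite /r2; under eq_fun do rewrite affineR.
  by move=> x; apply: cvgM; [exact: cvg_cst|exact: cbump].
have r1_ge0 n x : 0 <= r1 n x by rewrite mulr_ge0 ?bump_ge0// ltW.
have r2_ge0 n x : 0 <= r2 n x by rewrite mulr_ge0 ?bump_ge0// ltW.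
have i1 n : \int[mu]_(x in `[s, t]) r1 n x = step 1.
  have d (x : R) : is_derive x 1 (fun x : R => step (k n * (x - s) - 1)) (r1 n x).
    rewrite /r1; under eq_fun do rewrite affineL.
    by rewrite affineL; exact: is_derive_step_affine.
  rewrite (Rintegral_derive st (cr1 n) d).
  rewrite subrr mulr0 sub0r [X in _ - X]step_le0 ?subr0; last by lra.
  by rewrite step_ge1//; have := k_ge n; lra.
have i2 n : \int[mu]_(x in `[s, t]) r2 n x = step 1.
  have d (x : R) : is_derive x 1 (fun x : R => - step (k n * (t - x) - 1)) (r2 n x).
    rewrite /r2; under eq_fun do rewrite affineR.
    rewrite affineR -[X in X * bump _]opprK mulNr.
    by have := is_derive_step_affine (- k n) (k n * t - 1) x; exact: is_deriveN.
  rewrite (Rintegral_derive st (cr2 n) d).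
  rewrite subrr mulr0 sub0r step_le0; last by lra.
  by rewrite oppr0 sub0r opprK step_ge1//; have := k_ge n; lra.
have iyr n (r : R -> R) : continuous r ->
    mu.-integrable `[s, t] (EFin \o (fun x => y x * r x)).
  move=> cr; apply: continuous_integrable_itv => x.
  have cr' : {within `[s, t], continuous r} by exact: continuous_subspaceT.
  by apply: (@continuousM _ (subspace `[s, t])); [exact: cy|exact: cr'].
have B0 := @step1_gt0 R.
have [_ ys yt] := (continuous_within_itvP y st).1 cy.
apply/cvgrPdist_le => e e0.
pose e' := e / (2 * step 1).
have e'0 : 0 < e' by rewrite divr_gt0// mulr_gt0.
move: ys => /cvgrPdist_le/(_ _ e'0)[d1 /= d10 H1].
move: yt => /cvgrPdist_le/(_ _ e'0)[d2 /= d20 H2].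
near=> n.
have -> : \int[mu]_(x in `[s, t]) (y x * dcutoff (k n) s t x) =
    \int[mu]_(x in `[s, t]) (y x * r1 n x) - \int[mu]_(x in `[s, t]) (y x * r2 n x).
  rewrite -RintegralB//; [|exact: iyr|exact: iyr].
  by apply: eq_Rintegral => x _; rewrite -mulrBr.
have A1 : `|\int[mu]_(x in `[s, t]) (y x * r1 n x) - step 1 * y s| <= e' * step 1.
  apply: (Rintegral_approx cy (cr1 n) (r1_ge0 n) (i1 n)).
  move=> x /=; rewrite in_itv/= => /andP[sx xt].
  (* Where the bump does not vanish, 1 < k (x - s) < 2: the point x is within d1 of s and distinct
     from s, as the one-sided limit requires. *)
  rewrite mulf_eq0 negb_or => /andP[_ bx]; rewrite distrC; apply: H1.
    rewrite /= distrC ger0_norm ?subr_ge0// ltNge; apply/negP => dx.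
    have : 2 <= k n * d1 by near: n; exact: k_cvg.
    have := ler_wpM2l (ltW (k_gt0 n)) dx => ? ?.
    by move/eqP: bx; apply; apply: bump_ge1; lra.
  rewrite lt_neqAle sx andbT; apply/eqP => E.
  by move/eqP: bx; apply; apply: bump_le0; rewrite E subrr mulr0; lra.
have A2 : `|\int[mu]_(x in `[s, t]) (y x * r2 n x) - step 1 * y t| <= e' * step 1.
  apply: (Rintegral_approx cy (cr2 n) (r2_ge0 n) (i2 n)).
  move=> x /=; rewrite in_itv/= => /andP[sx xt].
  rewrite mulf_eq0 negb_or => /andP[_ bx]; rewrite distrC; apply: H2.
    rewrite /= ger0_norm ?subr_ge0// ltNge; apply/negP => dx.
    have : 2 <= k n * d2 by near: n; exact: k_cvg.
    have := ler_wpM2l (ltW (k_gt0 n)) dx => ? ?.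
    by move/eqP: bx; apply; apply: bump_ge1; lra.
  rewrite lt_neqAle xt andbT; apply/eqP => E.
  by move/eqP: bx; apply; apply: bump_le0; rewrite E subrr mulr0; lra.
have ee : e' * step 1 = e / 2 by rewrite /e'; field; rewrite gt_eqF.
move: A1 A2; rewrite ee distrC => A1 A2.
rewrite [leRHS](splitr e).
have rearrange (u v w z : R) : u - v - (w - z) = (u - w) + (z - v) by ring.
rewrite rearrange.
by apply: (le_trans (ler_normD _ _)); rewrite lerD.
Unshelve. all: by end_near. Qed.

Let cvg_rhs : (\int[mu]_(x in `]s, t[) (h x * cutoff (k n) s t x)) @[n --> \oo]
  --> (step 1 * \int[mu]_(x in `]s, t[) h x : R).
Proof.
have mst : measurable (`]s, t[%classic : set R) by exact: measurable_itv.
have mh : measurable_fun `]s, t[ h.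
  by case/integrableP : ih => /measurable_EFinP.
have mc n : measurable_fun (`]s, t[%classic : set R) (cutoff (k n) s t).
  apply: measurable_funTS; apply: continuous_measurable_fun.
  exact: cutoff_continuous.
have m1 n : measurable_fun `]s, t[ (fun x => (h x * cutoff (k n) s t x)%:E).
  by apply/measurable_EFinP; exact: measurable_funM.
have m2 : measurable_fun `]s, t[ (fun x => (step 1 * h x)%:E).
  by apply/measurable_EFinP; exact: measurable_funM.
have cvg : {ae mu, forall x, `]s, t[ x ->
    (h x * cutoff (k n) s t x)%:E @[n --> \oo] --> (step 1 * h x)%:E}.
  apply: aeW => x; rewrite /= in_itv/= => /andP[sx xt].
  apply: cvg_near_cst; near=> n; rewrite [h x * _]mulrC cutoff_eq//.
  + by near: n; apply: k_cvg; rewrite subr_gt0.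
  + by near: n; apply: k_cvg; rewrite subr_gt0.
have ig : mu.-integrable `]s, t[ (fun x => (step 1 * `|h x|)%:E).
  exact: integrable_scale (integrable_norm ih).
have fg : {ae mu, forall x n, `]s, t[ x ->
    (`|(h x * cutoff (k n) s t x)%:E| <= (step 1 * `|h x|)%:E)%E}.
  apply: aeW => x n _ /=; rewrite lee_fin normrM mulrC ler_wpM2r//.
  by have /andP[c0 c1] := cutoff_bound x (k_ge n); rewrite ger0_norm.
have [_ _ H] := @dominated_convergence _ _ _ mu _ mst
  (fun n x => (h x * cutoff (k n) s t x)%:E) (fun x => (step 1 * h x)%:E)
  (fun x => (step 1 * `|h x|)%:E) m1 m2 cvg ig fg.
rewrite -RintegralZl//.
apply: fine_cvg; rewrite fineK; first exact: H.
by apply: integrable_fin_num => //; exact: integrable_scale.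
Unshelve. all: by end_near. Qed.

(** The cut-offs tend to [step 1] times the indicator of ]s, t[; passing to the limit in the weak
    formulation gives the identity multiplied by [step 1]. *)
Lemma weak_derivative_FTC : y t - y s = \int[mu]_(x in `]s, t[) h x.
Proof.
have H : (- \int[mu]_(x in `]s, t[) (h x * cutoff (k n) s t x)) @[n --> \oo]
    --> (- (step 1 * \int[mu]_(x in `]s, t[) h x) : R).
  by apply: cvgN; exact: cvg_rhs.
have := cvg_lhs; under eq_fun do rewrite weak_cutoff.
move=> /(cvg_unique _ H) - /(_ (@Rhausdorff R)) E.
have B0 := @step1_gt0 R.
apply: (mulfI (x := step 1)); first by rewrite gt_eqF.
by rewrite -[RHS]opprK E; ring.
Qed.

End weak_derivative_FTC.

(** * Square-integrable functions and the Fubini theorem *)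

Section square_integrable.
Context d {X : measurableType d} {R : realType}.
Variables (m : {measure set X -> \bar R}) (D : set X).
Hypothesis mD : measurable D.
Implicit Types (f g h : X -> R) (c e : R).

(** Working form of membership in [Lfun m 2] for the function cut off outside D; [Lfun2_sqint] is
    the equivalence. *)
Definition sqint f :=
  measurable_fun D f /\ m.-integrable D (EFin \o (fun x => f x ^+ 2)).

Definition ip f g : R := \int[m]_(x in D) (f x * g x).

Lemma sqint_le f g : measurable_fun D f -> sqint g ->
  (forall x, D x -> f x ^+ 2 <= g x ^+ 2) -> sqint f.
Proof.
move=> mf [mg ig] fg; split=> //.
apply: le_integrable ig => //.
  by apply/measurable_EFinP; exact: measurable_funX.
by move=> x Dx /=; rewrite lee_fin !ger0_norm ?sqr_ge0// fg.
Qed.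

Lemma sqintM f g : sqint f -> sqint g ->
  m.-integrable D (EFin \o (fun x => f x * g x)).
Proof.
move=> [mf jf] [mg jg]; apply: le_integrable (integrable_add mD jf jg) => //.
  by apply/measurable_EFinP; exact: measurable_funM.
move=> x _ /=; rewrite lee_fin [leRHS]ger0_norm ?addr_ge0 ?sqr_ge0//.
rewrite normrM -(real_normK (num_real (f x))) -(real_normK (num_real (g x))).
have := sqr_ge0 (`|f x| - `|g x|).
have := mulr_ge0 (normr_ge0 (f x)) (normr_ge0 (g x)); nra.
Qed.

Lemma sqintZ c f : sqint f -> sqint (c \*o f).
Proof.
move=> [mf jf]; split; first exact: measurable_funM.
by under eq_fun do rewrite exprMn; exact: integrable_scale.
Qed.

Lemma sqintD f g : sqint f -> sqint g -> sqint (f \+ g).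
Proof.
move=> [mf jf] [mg jg]; split; first exact: measurable_funD.
apply: le_integrable
  (integrable_add mD (integrable_scale 2 mD jf) (integrable_scale 2 mD jg)) => //.
  by apply/measurable_EFinP/measurable_funX; exact: measurable_funD.
move=> x _ /=; rewrite lee_fin !ger0_norm ?sqr_ge0//.
  by have := sqr_ge0 (f x - g x); nra.
by rewrite addr_ge0// mulr_ge0 ?sqr_ge0.
Qed.

Lemma sqintB f g : sqint f -> sqint g -> sqint (f \- g).
Proof.
move=> jf /(sqintZ (-1)) jg; have := sqintD jf jg.
by rewrite (_ : f \+ _ = f \- g)//; apply/funext => x /=; rewrite mulN1r.
Qed.

Lemma sqint_mull c f g : measurable_fun D f -> (forall x, D x -> `|f x| <= c) ->
  sqint g -> sqint (f \* g).
Proof.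
move=> mf fc jg; have [mg _] := jg.
apply: sqint_le (sqintZ c jg) _; first exact: measurable_funM.
move=> x Dx /=; rewrite !exprMn ler_wpM2r ?sqr_ge0//.
rewrite -(real_normK (num_real (f x))) ler_sqr ?nnegrE// ?fc//.
exact: le_trans (fc x Dx).
Qed.

Lemma ipC f g : ip f g = ip g f.
Proof. by apply: eq_Rintegral => x _; rewrite mulrC. Qed.

Lemma ipDl f g h : sqint f -> sqint g -> sqint h ->
  ip (f \+ g) h = ip f h + ip g h.
Proof.
move=> jf jg jh; rewrite /ip -RintegralD//; [|exact: sqintM|exact: sqintM].
by apply: eq_Rintegral => x _ /=; rewrite mulrDl.
Qed.

Lemma ipBl f g h : sqint f -> sqint g -> sqint h ->
  ip (f \- g) h = ip f h - ip g h.
Proof.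
move=> jf jg jh; rewrite /ip -RintegralB//; [|exact: sqintM|exact: sqintM].
by apply: eq_Rintegral => x _ /=; rewrite mulrBl.
Qed.

Lemma ipZl c f g : sqint f -> sqint g -> ip (c \*o f) g = c * ip f g.
Proof.
move=> jf jg; rewrite /ip -RintegralZl//; last exact: sqintM.
by apply: eq_Rintegral => x _ /=; rewrite mulrA.
Qed.

Lemma ipDr f g h : sqint f -> sqint g -> sqint h ->
  ip h (f \+ g) = ip h f + ip h g.
Proof. by move=> *; rewrite ipC ipDl// !(ipC h). Qed.

Lemma ipBr f g h : sqint f -> sqint g -> sqint h ->
  ip h (f \- g) = ip h f - ip h g.
Proof. by move=> *; rewrite ipC ipBl// !(ipC h). Qed.

Lemma ipZr c f g : sqint f -> sqint g -> ip g (c \*o f) = c * ip g f.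
Proof. by move=> *; rewrite ipC ipZl// ipC. Qed.

Lemma ip_ge0 f : 0 <= ip f f.
Proof. by apply: Rintegral_ge0 => x _; rewrite -expr2 sqr_ge0. Qed.

Lemma eq_ip f f' g g' : (forall x, D x -> f x = f' x) ->
  (forall x, D x -> g x = g' x) -> ip f g = ip f' g'.
Proof.
by move=> ff gg; apply: eq_Rintegral => x /set_mem Dx; rewrite ff// gg.
Qed.

Lemma ae_eq_ip f f' g g' : measurable_fun D f -> measurable_fun D f' ->
  measurable_fun D g -> measurable_fun D g' ->
  {ae m, forall x, D x -> f x = f' x} ->
  {ae m, forall x, D x -> g x = g' x} -> ip f g = ip f' g'.
Proof.
move=> mf mf' mg mg' ff gg; congr fine; apply: ae_eq_integral => //.
- by apply/measurable_EFinP; exact: measurable_funM.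
- by apply/measurable_EFinP; exact: measurable_funM.
by apply: filterS2 ff gg => x ff gg Dx; rewrite ff// gg.
Qed.

(** Expand the square norm of f - g/e and multiply by e. The free weight e is what every later
    absorption argument tunes. *)
Lemma ip_young e f g : 0 < e -> sqint f -> sqint g ->
  2 * ip f g <= e * ip f f + e^-1 * ip g g.
Proof.
move=> e0 jf jg.
have := ip_ge0 (f \- e^-1 \*o g).
have jg' := sqintZ e^-1 jg; have jd := sqintB jf jg'.
rewrite ipBl// !ipBr// !ipZl// !ipZr// (ipC g f) => H.
have := mulr_ge0 (ltW e0) H.
rewrite [X in 0 <= X -> _](_ : _ = e * ip f f + e^-1 * ip g g - 2 * ip f g).
  by rewrite subr_ge0.
by field; rewrite gt_eqF.
Qed.

Lemma ip_le f g f' g' : sqint f -> sqint g -> sqint f' -> sqint g' ->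
  (forall x, D x -> f x * g x <= f' x * g' x) -> ip f g <= ip f' g'.
Proof. by move=> *; apply: le_Rintegral => //; exact: sqintM. Qed.

End square_integrable.

Section integral_fine.
Context d (X : measurableType d) (R : realType).

Lemma integrable_fine (m : {measure set X -> \bar R}) (D : set X)
    (g : X -> \bar R) : measurable D -> m.-integrable D g ->
  m.-integrable D (EFin \o (fine \o g)).
Proof.
move=> mD ig; apply: le_integrable (ig) => //.
  apply/measurable_EFinP; apply: (measurable_comp measurableT) => //.
  exact: measurable_int ig.
by move=> x _ /=; case: (g x) => //= ; rewrite ?normr0 ?leey.
Qed.

(** Inner integrals in Fubini's theorem are finite only almost everywhere; [fine] replaces the
    infinite ones by 0, which changes a null set only. *)
Lemma Rintegral_fine (m : {measure set X -> \bar R}) (D : set X)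
    (g : X -> \bar R) : measurable D -> m.-integrable D g ->
  \int[m]_(x in D) fine (g x) = fine (\int[m]_(x in D) g x)%E.
Proof.
move=> mD ig; congr fine; apply: ae_eq_integral => //.
- exact: measurable_int (integrable_fine mD ig).
- exact: measurable_int ig.
- by apply: filterS (integrable_ae mD ig) => x + Dx => /(_ Dx) /fineK.
Qed.

End integral_fine.

Section fubini.
Context d1 d2 (X : measurableType d1) (Y : measurableType d2) (R : realType).

Variables (m1 : {sigma_finite_measure set X -> \bar R})
          (m2 : {sigma_finite_measure set Y -> \bar R}).
Variables (D : set X) (E : set Y) (F : X * Y -> R).
Hypotheses (mD : measurable D) (mE : measurable E).
Hypothesis iF : (m1 \x m2)%E.-integrable (D `*` E) (EFin \o F).

(** Extension by 0, which turns integrals over D and E into integrals over the whole spaces. *)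
Let f := (EFin \o F) \_ (D `*` E).

Let mDE : measurable (D `*` E). Proof. exact: measurableX. Qed.

Let jf : (m1 \x m2)%E.-integrable setT f.
Proof. exact: (integrable_mkcond _ mDE).1 iF. Qed.

Let fE x y : f (x, y) =
  if x \in D then ((fun y => (F (x, y))%:E) \_ E) y else 0%E.
Proof.
rewrite /f !patchE/=; case: (boolP (x \in D)) => xD; case: (boolP (y \in E)) => yE.
- by rewrite mem_set//; split; exact/set_mem.
- by rewrite memNset// => -[_ /=/mem_set]; exact/negP.
- by rewrite memNset// => -[/=/mem_set + _]; exact/negP.
- by rewrite memNset// => -[/=/mem_set + _]; exact/negP.
Qed.

Let fE' x y : f (x, y) =
  if y \in E then ((fun x => (F (x, y))%:E) \_ D) x else 0%E.
Proof. by rewrite fE !patchE; case: ifP; case: ifP. Qed.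

Lemma fubini_ae_integrable :
  {ae m1, forall x, D x -> m2.-integrable E (fun y => (F (x, y))%:E)}.
Proof.
apply: filterS (ae_integrable1 jf) => x + Dx.
under eq_fun do rewrite fE mem_set//.
by move=> ?; apply/integrable_mkcond.
Qed.

Let FE : {in D, fubini_F m2 f =1 (fun x => \int[m2]_(y in E) (F (x, y))%:E)%E}.
Proof.
move=> x xD; rewrite /fubini_F [RHS]integral_mkcond.
by apply: eq_integral => y _; rewrite fE xD.
Qed.

Let GE : {in E, fubini_G m1 f =1 (fun y => \int[m1]_(x in D) (F (x, y))%:E)%E}.
Proof.
move=> y yE; rewrite /fubini_G [RHS]integral_mkcond.
by apply: eq_integral => x _; rewrite fE' yE.
Qed.

Let iFD : m1.-integrable D (fun x => \int[m2]_(y in E) (F (x, y))%:E)%E.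
Proof.
apply: eq_integrable FE _ => //.
exact: integrableS measurableT mD (@subsetT _ _) (integrable_fubini_F jf).
Qed.

Let iGE : m2.-integrable E (fun y => \int[m1]_(x in D) (F (x, y))%:E)%E.
Proof.
apply: eq_integrable GE _ => //.
apply: integrableS measurableT mE (@subsetT _ _) _.
have mf := measurable_int _ jf.
apply/integrableP; split; first exact: measurable_fubini_G jf.
apply: le_lt_trans ((integrable21ltyP _ _ mf).1 jf).
apply: ge0_le_integral => //.
- by apply: measurableT_comp => //; exact: measurable_fubini_G jf.
- apply: (measurable_fun_fubini_tonelli_G (abse \o f)) => //.
  exact: measurableT_comp.
- by move=> x; exact: abse_ge0.
- move=> y _; apply: le_abse_integral => //.
  exact: measurable_fun_pair1.
Qed.

Lemma fubini_integrable :
  m1.-integrable D (EFin \o (fun x => \int[m2]_(y in E) F (x, y))).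
Proof. exact: integrable_fine iFD. Qed.

Lemma fubini_ae_integrable2 :
  {ae m2, forall y, E y -> m1.-integrable D (fun x => (F (x, y))%:E)}.
Proof.
apply: filterS (ae_integrable2 jf) => y + Ey.
under eq_fun do rewrite fE' mem_set//.
by move=> ?; apply/integrable_mkcond.
Qed.

Lemma fubini_integrable2 :
  m2.-integrable E (EFin \o (fun y => \int[m1]_(x in D) F (x, y))).
Proof. exact: integrable_fine iGE. Qed.

Lemma fubini_Rintegral1 :
  \int[m1]_(x in D) (\int[m2]_(y in E) F (x, y)) =
  \int[(m1 \x m2)%E]_(z in D `*` E) F z.
Proof.
rewrite (Rintegral_fine mD iFD) /Rintegral; congr fine.
have -> : (\int[m1 \x m2]_(z in D `*` E) (F z)%:E = \int[m1 \x m2]_z f z)%E.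
  exact: integral_mkcond.
rewrite -(integral12_prod_meas1 jf) [LHS]integral_mkcond.
apply: eq_integral => x _; rewrite patchE; case: ifPn => xD; first by rewrite FE.
by rewrite /fubini_F integral0_eq// => y _; rewrite fE (negbTE xD).
Qed.

Lemma fubini_Rintegral2 :
  \int[m2]_(y in E) (\int[m1]_(x in D) F (x, y)) =
  \int[(m1 \x m2)%E]_(z in D `*` E) F z.
Proof.
rewrite (Rintegral_fine mE iGE) /Rintegral; congr fine.
have -> : (\int[m1 \x m2]_(z in D `*` E) (F z)%:E = \int[m1 \x m2]_z f z)%E.
  exact: integral_mkcond.
rewrite -(integral21_prod_meas1 jf) [LHS]integral_mkcond.
apply: eq_integral => y _; rewrite patchE; case: ifPn => yE; first by rewrite GE.
by rewrite /fubini_G integral0_eq// => x _; rewrite fE' (negbTE yE).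
Qed.

End fubini.

Section lfun2.
Context d {X : measurableType d} {R : realType}.
Variables (m : {measure set X -> \bar R}) (D : set X).
Hypothesis mD : measurable D.
Implicit Type f : X -> R.

Lemma Lfun2_sqint f : (f \_ D) \in Lfun m 2%:E <-> sqint m D f.
Proof.
have sqE : (fun x => (f \_ D) x ^+ 2) = (fun x => f x ^+ 2) \_ D.
  by apply/funext => x; rewrite !patchE; case: ifP; rewrite ?expr0n.
split=> [Lf|[mf jf]].
  split.
    apply/(measurable_restrictT _ mD).2.
    by move: Lf; rewrite inE => /andP[+ _]; rewrite inE.
  apply/integrable_mkcond => //.
  by have := Lfun2_integrable_sqr Lf; rewrite sqE restrict_EFin.
rewrite inE; apply/andP; split; rewrite inE/=.
  exact/(measurable_restrictT _ mD).1.
rewrite /finite_norm; apply: (@lty_poweRy _ _ 2) => //.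
rewrite powR_Lnorm//.
have := (integrable_mkcond _ mD).1 jf; rewrite restrict_EFin -sqE.
case/integrableP => _; apply: le_lt_trans; rewrite le_eqVlt; apply/orP; left.
apply/eqP/eq_integral => x _ /=.
by rewrite powR_mulrn// normrX.
Qed.

Lemma Lnorm2_ip f : sqint m D f ->
  (fine 'N[m]_2%:E [EFin \o (f \_ D)]) ^+ 2 = ip m D f f.
Proof.
move=> /[dup] [[mf jf]] /Lfun2_sqint.
rewrite inE => /andP[_]; rewrite inE/= /finite_norm => Nf.
have N0 := Lnorm_ge0 m 2%:E (EFin \o f \_ D).
apply: EFin_inj; rewrite -powR_mulrn ?fine_ge0// -poweR_EFin fineK ?ge0_fin_numE//.
rewrite powR_Lnorm// /ip /Rintegral fineK.
  rewrite [RHS]integral_mkcond; apply: eq_integral => x _ /=.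
  rewrite powR_mulrn// real_normK ?num_real// !patchE.
  by case: ifP; rewrite ?expr0n.
exact: integrable_fin_num.
Qed.

End lfun2.

Section ae_Rintegral.
Context d (X : measurableType d) (R : realType).
Variables (m : {measure set X -> \bar R}) (D : set X).

Lemma ae_mono (P Q : X -> Prop) : (forall x, P x -> Q x) ->
  {ae m, forall x, P x} -> {ae m, forall x, Q x}.
Proof. by move=> PQ; exact: filterS. Qed.

Lemma ae_and (P Q : X -> Prop) :
  {ae m, forall x, P x} -> {ae m, forall x, Q x} ->
  {ae m, forall x, P x /\ Q x}.
Proof. by move=> HP HQ; apply: filterS2 HP HQ. Qed.

Hypothesis mD : measurable D.

Lemma integrable_ext (f g : X -> R) : (forall x, f x = g x) ->
  m.-integrable D (EFin \o f) -> m.-integrable D (EFin \o g).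
Proof. by move=> fg; rewrite (_ : f = g)//; exact/funext. Qed.

(** When the positive or the negative part has an infinite integral, [fine] makes both sides 0. *)
Lemma RintegralN (f : X -> R) :
  \int[m]_(x in D) - f x = - \int[m]_(x in D) f x.
Proof.
rewrite /Rintegral integralE [in RHS]integralE.
have -> : (fun x => (- f x)%:E) = -%E \o (EFin \o f) by [].
rewrite funeposN funenegN.
have := @integral_ge0 _ _ _ m D (EFin \o f)^\+%E (fun x _ => funepos_ge0 _ x).
have := @integral_ge0 _ _ _ m D (EFin \o f)^\-%E (fun x _ => funeneg_ge0 _ x).
case: (integral m D _) => [a| |]; case: (integral m D _) => [b| |] //= _ _.
- by rewrite opprB.
- by rewrite oppr0.
- by rewrite oppr0.
- by rewrite oppr0.
Qed.

Lemma ae_eq_Rintegral (f g : X -> R) :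
  measurable_fun D f -> measurable_fun D g ->
  {ae m, forall x, D x -> f x = g x} ->
  \int[m]_(x in D) f x = \int[m]_(x in D) g x.
Proof.
move=> mf mg fg; congr fine; apply: ae_eq_integral => //.
- exact/measurable_EFinP.
- exact/measurable_EFinP.
- by apply: filterS fg => x fg /fg ->.
Qed.

Lemma ae_le_Rintegral (f g : X -> R) :
  m.-integrable D (EFin \o f) -> m.-integrable D (EFin \o g) ->
  {ae m, forall x, D x -> f x <= g x} ->
  \int[m]_(x in D) f x <= \int[m]_(x in D) g x.
Proof.
move=> jf jg fg; rewrite -subr_ge0 -RintegralB//.
have jgf := integrable_sub mD jg jf.
rewrite (@ae_eq_Rintegral _ (fun x => `|g x - f x|)).
- by apply: Rintegral_ge0.
- exact/measurable_EFinP/(measurable_int _ jgf).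
- exact/measurable_EFinP/(measurable_int _ (integrable_norm jgf)).
- by apply: filterS fg => x fg /fg ?; rewrite ger0_norm ?subr_ge0.
Qed.

End ae_Rintegral.

Section fubini_weights.
Context d1 d2 (X : measurableType d1) (Y : measurableType d2) (R : realType).
Variables (m1 : {sigma_finite_measure set X -> \bar R})
          (m2 : {sigma_finite_measure set Y -> \bar R}).
Variables (D : set X) (E : set Y).
Hypotheses (mD : measurable D) (mE : measurable E).

Lemma fubini_weight1 (F : X * Y -> R) (k : X -> R) : measurable_fun D k ->
  (m1 \x m2)%E.-integrable (D `*` E) (EFin \o F) ->
  (m1 \x m2)%E.-integrable (D `*` E) (EFin \o (fun z => F z * k z.1)) ->
  \int[m1]_(x in D) (\int[m2]_(y in E) F (x, y) * k x) =
  \int[(m1 \x m2)%E]_(z in D `*` E) (F z * k z.1).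
Proof.
move=> mk iF iFk; rewrite -(fubini_Rintegral1 mD mE iFk).
apply: ae_eq_Rintegral => //.
- apply: measurable_funM => //.
  exact/measurable_EFinP/(measurable_int _ (fubini_integrable mD mE iF)).
- exact/measurable_EFinP/(measurable_int _ (fubini_integrable mD mE iFk)).
- apply: filterS (fubini_ae_integrable mD mE iF) => x + Dx => /(_ Dx) Fx.
  by rewrite -RintegralZr.
Qed.

Lemma fubini_weight2 (F : X * Y -> R) (k : Y -> R) : measurable_fun E k ->
  (m1 \x m2)%E.-integrable (D `*` E) (EFin \o F) ->
  (m1 \x m2)%E.-integrable (D `*` E) (EFin \o (fun z => F z * k z.2)) ->
  \int[m2]_(y in E) (\int[m1]_(x in D) F (x, y) * k y) =
  \int[(m1 \x m2)%E]_(z in D `*` E) (F z * k z.2).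
Proof.
move=> mk iF iFk; rewrite -(fubini_Rintegral2 mD mE iFk).
apply: ae_eq_Rintegral => //.
- apply: measurable_funM => //.
  exact/measurable_EFinP/(measurable_int _ (fubini_integrable2 mD mE iF)).
- exact/measurable_EFinP/(measurable_int _ (fubini_integrable2 mD mE iFk)).
- apply: filterS (fubini_ae_integrable2 mD mE iF) => y + Ey => /(_ Ey) Fy.
  by rewrite -RintegralZr.
Qed.

Lemma measurable_section1 (F : X * Y -> R) x : D x ->
  measurable_fun (D `*` E) F -> measurable_fun E (fun y => F (x, y)).
Proof.
move=> Dx mF; apply/(measurable_restrictT _ mE).2.
have mDE : measurable (D `*` E) by exact: measurableX.
have := measurable_fun_pair2 x ((measurable_restrictT F mDE).1 mF).
congr (measurable_fun _ _); apply/funext => y; rewrite !patchE.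
case: (boolP (y \in E)) => yE.
  by rewrite mem_set//; split => //; exact/set_mem.
by rewrite memNset// => -[_ /=/mem_set]; exact/negP.
Qed.

Lemma measurable_fst_dom (k : X -> R) : measurable_fun D k ->
  measurable_fun (D `*` E) (fun z : X * Y => k z.1).
Proof.
move=> mk; have mDE : measurable (D `*` E) by exact: measurableX.
have mk' := (measurable_restrictT k mD).1 mk.
apply: (@eq_measurable_fun _ _ _ _ _ (fun z : X * Y => (k \_ D) z.1)).
  by move=> z /set_mem[Dz _]; rewrite patchE mem_set.
by apply: measurable_funTS; apply: (measurableT_comp mk').
Qed.

Lemma measurable_snd_dom (k : Y -> R) : measurable_fun E k ->
  measurable_fun (D `*` E) (fun z : X * Y => k z.2).
Proof.
move=> mk; have mDE : measurable (D `*` E) by exact: measurableX.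
have mk' := (measurable_restrictT k mE).1 mk.
apply: (@eq_measurable_fun _ _ _ _ _ (fun z : X * Y => (k \_ E) z.2)).
  by move=> z /set_mem[_ Dz]; rewrite patchE mem_set.
by apply: measurable_funTS; apply: (measurableT_comp mk').
Qed.

Lemma sqint_snd (g : Y -> R) : (m1 D < +oo)%E -> sqint m2 E g ->
  sqint (m1 \x m2)%E (D `*` E) (fun z => g z.2).
Proof.
move=> Doo [mg jg]; split; first exact: measurable_snd_dom.
have mDE : measurable (D `*` E) by exact: measurableX.
have mg2 := measurable_snd_dom (measurable_funX 2 mg).
apply/(integrable_mkcond _ mDE).
have mr := (measurable_restrictT _ mDE).1 (proj2 (measurable_EFinP _ _) mg2).
apply/integrable12ltyP => //.
rewrite (_ : (fun x => _) = (fun x =>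
    (\int[m2]_(y in E) (g y ^+ 2)%:E) * (\1_D x)%:E)%E); last first.
  apply/funext => x; rewrite indicE; case: (boolP (x \in D)) => xD.
    rewrite mule1 [RHS]integral_mkcond; apply: eq_integral => y _.
    rewrite !patchE; case: (boolP (y \in E)) => yE.
      rewrite mem_set; last by split; exact/set_mem.
      by rewrite /= ger0_norm ?sqr_ge0.
    rewrite memNset; [exact: abse0|by move=> [_ /=/mem_set]; exact/negP].
  rewrite /= mule0 integral0_eq// => y _; rewrite patchE memNset.
    exact: abse0.
  by move=> [/=/mem_set + _]; exact/negP.
rewrite ge0_integralZl//.
- rewrite integral_indic// setIT lte_mul_pinfty//.
  + by apply: integral_ge0 => y _; rewrite lee_fin sqr_ge0.
  + exact: integrable_fin_num jg.
- exact/measurable_EFinP.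
- by apply: integral_ge0 => y _; rewrite lee_fin sqr_ge0.
Qed.

End fubini_weights.

(** * Energy inequality *)

Section young.
Context d {X : measurableType d} {R : realType}.
Variables (m : {measure set X -> \bar R}) (D : set X).
Hypothesis mD : measurable D.

Lemma ip_young_norm (e : R) (f g : X -> R) : 0 < e ->
  sqint m D f -> sqint m D g ->
  2 * `|ip m D f g| <= e * ip m D f f + e^-1 * ip m D g g.
Proof.
move=> e0 jf jg; have H1 := ip_young mD e0 jf jg.
have jf' := sqintZ mD (-1) jf.
have := ip_young mD e0 jf' jg; rewrite !ipZl// !ipZr// => H2.
by have [h|h] := leP 0 (ip m D f g); [rewrite ger0_norm|rewrite ltr0_norm]; lra.
Qed.

Lemma sqint_cst (c : R) : (m D < +oo)%E -> sqint m D (cst c).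
Proof.
move=> Doo; split => //.
rewrite (_ : EFin \o _ = cst (c ^+ 2)%:E)//.
apply/integrableP; split; first exact: measurable_cst.
by rewrite (_ : (fun _ => _) = cst `|(c ^+ 2)%:E|%E)// integral_cst// lte_mul_pinfty.
Qed.

End young.

Lemma continuous_itv_bounded (R : realType) (a b : R) (f : R -> R) :
  continuous f -> exists c, forall x, `[a, b] x -> `|f x| <= c.
Proof.
move=> cf; have [ab|ba] := leP a b; last first.
  exists 0 => x; rewrite /= in_itv/= => /andP[ax xb].
  by have := lt_le_trans ba (le_trans ax xb); rewrite ltxx.
have [|c _ H] := @EVT_max R (fun x => `|f x|) a b ab.
  by apply: continuous_subspaceT => x; apply: cvg_norm; exact: cf.
by exists `|f c| => x xab; exact: H.
Qed.

Lemma smooth_continuous (R : realType) n (f : R -> R) :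
  smooth_on setT f -> continuous (derive1n n f).
Proof.
move=> sf x; apply/differentiable_continuous/derivable1_diffP; exact: sf.
Qed.

(** * Functions with a weak time derivative: from scalar pairings to the energy inequality *)

Section H1L2.
Context {R : realType}.
Local Notation mu := (@lebesgue_measure R).
Variables (l T : R).
Hypotheses (l0 : 0 < l) (T0 : 0 < T).
Local Notation I := (`]0, l[%classic : set R).
Local Notation J := (`]0, T[%classic : set R).
Local Notation Q := (J `*` I).
Local Notation mQ := (mu \x mu)%E.
Local Notation unc v := (fun z : R * R => v z.1 z.2).
Local Notation sqx := (sqint mu I).
Local Notation sqQ := (sqint mQ Q).
Local Notation ipx := (ip mu I).

Local Notation RM := (measurableTypeR R).
Let mI : @measurable _ RM I. Proof. exact: measurable_itv. Qed.
Let mJ : @measurable _ RM J. Proof. exact: measurable_itv. Qed.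
Let mJI : @measurable _ (RM * RM)%type Q. Proof. exact: measurableX. Qed.

Lemma itv0_finite (b : R) : (mu (`]0%R, b[%classic : set R) < +oo)%E.
Proof. by rewrite lebesgue_measure_itv/=; case: ifP => _; rewrite ?ltry. Qed.

Lemma inL2_sqint (f : R -> R) : inL2 l f <-> sqx f.
Proof. exact: Lfun2_sqint. Qed.

Lemma inL2Q_sqint (v : R -> R -> R) : inL2Q l T v <-> sqQ (unc v).
Proof. exact: Lfun2_sqint. Qed.

Lemma L2norm_ip (f : R -> R) : sqx f -> L2norm l f ^+ 2 = ipx f f.
Proof. exact: Lnorm2_ip. Qed.

Lemma L2norm_ge0 (f : R -> R) : 0 <= L2norm l f.
Proof. by apply: fine_ge0; exact: Lnorm_ge0. Qed.

Lemma sqint_test (v : R -> R -> R) (eta : R -> R) : continuous eta ->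
  sqQ (unc v) -> sqQ (fun z => v z.1 z.2 * eta z.1).
Proof.
move=> ceta jv; have [c cP] := continuous_itv_bounded 0 T ceta.
have meta : measurable_fun Q (fun z : R * R => eta z.1).
  apply: measurable_fst_dom => //; apply: measurable_funTS.
  exact: continuous_measurable_fun.
have := @sqint_mull _ _ _ mQ _ mJI c _ (unc v) meta _ jv.
rewrite (_ : _ \* _ = (fun z => v z.1 z.2 * eta z.1)).
  by apply => z [/subset_itv_oo_cc/cP].
by apply/funext => z /=; rewrite mulrC.
Qed.

Lemma integrable_pairing (v : R -> R -> R) (g : R -> R) :
  sqQ (unc v) -> sqx g -> mQ.-integrable Q (EFin \o (fun z => v z.1 z.2 * g z.2)).
Proof.
move=> jv jg; apply: (@sqintM _ _ _ mQ Q mJI (unc v) (fun z => g z.2) jv).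
exact: (@sqint_snd _ _ _ _ _ mu mu J I mJ mI g (itv0_finite T) jg).
Qed.

Lemma integrable_test (v : R -> R -> R) (eta : R -> R) : sqQ (unc v) ->
  continuous eta -> mQ.-integrable Q (EFin \o (fun z => v z.1 z.2 * eta z.1)).
Proof.
move=> jv ceta.
have := @integrable_pairing (fun r x => v r x * eta r) (cst 1)
  (sqint_test ceta jv) (sqint_cst mI 1 (itv0_finite l)).
by apply: integrable_ext => z /=; rewrite mulr1.
Qed.

(** Fubini's theorem transfers the weak time derivative, which [inH1L2] states at almost every x, to
    the scalar function t -> <v(t), g>. *)
Lemma ip_time_test (v : R -> R -> R) (g eta : R -> R) :
  sqQ (unc v) -> sqx g -> continuous eta ->
  \int[mu]_(r in J) (ipx (v r) g * eta r) =
  \int[mu]_(x in I) ((\int[mu]_(r in J) (v r x * eta r)) * g x).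
Proof.
move=> jv jg ceta; have jve := sqint_test ceta jv.
have meta (A : set R) : measurable_fun A eta.
  by apply: measurable_funTS; exact: continuous_measurable_fun.
have i1 := integrable_pairing jv jg.
have i12 : mQ.-integrable Q (EFin \o (fun z => v z.1 z.2 * eta z.1 * g z.2)).
  exact: (@integrable_pairing (fun r x => v r x * eta r) g jve jg).
have i2 : mQ.-integrable Q (EFin \o (fun z => v z.1 z.2 * eta z.1)).
  exact: integrable_test.
have -> := @fubini_weight1 _ _ _ _ R mu mu J I mJ mI
  (fun z => v z.1 z.2 * g z.2) eta (meta _) i1 _.
  have -> := @fubini_weight2 _ _ _ _ R mu mu J I mJ mI
    (fun z => v z.1 z.2 * eta z.1) g jg.1 i2 i12.
  by apply: eq_Rintegral => z _; rewrite mulrAC.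
by apply: integrable_ext i12 => z; rewrite mulrAC.
Qed.

Variables (u ut : R -> R -> R).
Hypothesis Hu : inH1L2 l T u ut.

Lemma H1L2_sqQ : sqQ (unc u).
Proof. by case: Hu => /inL2Q_sqint. Qed.

Lemma H1L2_dt_sqQ : sqQ (unc ut).
Proof. by case: Hu => _ /inL2Q_sqint. Qed.

Lemma H1L2_sqx t : `[0, T] t -> sqx (u t).
Proof. by case: Hu => _ _ _ + _ => /(_ t) H /H/inL2_sqint. Qed.

Lemma ae_section_sqx (v : R -> R -> R) : sqQ (unc v) ->
  {ae mu, forall t, J t -> sqx (v t)}.
Proof.
move=> [mv jv].
apply: filterS (@fubini_ae_integrable _ _ _ _ _ mu mu J I _ mJ mI jv) => t H Jt.
split; last exact: H.
exact: (@measurable_section1 _ _ RM RM R J I mJ mI (unc v) t Jt mv).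
Qed.

Lemma ip_integrable (v w : R -> R -> R) : sqQ (unc v) -> sqQ (unc w) ->
  mu.-integrable J (EFin \o (fun t => ipx (v t) (w t))).
Proof.
move=> jv jw.
exact: (@fubini_integrable _ _ _ _ _ mu mu J I _ mJ mI (sqintM mJI jv jw)).
Qed.

Lemma ip_integrable_fixed (v : R -> R -> R) (g : R -> R) :
  sqQ (unc v) -> sqx g -> mu.-integrable J (EFin \o (fun t => ipx (v t) g)).
Proof.
move=> jv jg.
exact: (@fubini_integrable _ _ _ _ _ mu mu J I _ mJ mI (integrable_pairing jv jg)).
Qed.

Lemma H1L2_weakly_continuous (g : R -> R) : sqx g ->
  {within `[0, T], continuous (fun t => ipx (u t) g)}.
Proof.
move=> jg; apply/subspace_continuousP => s sT; apply/cvgrPdist_le => e e0.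
have [_ _ _ _ /(_ s sT) /cvgrPdist_le Hs] := Hu.
(* With |u(t) - u(s)| <= min(c, e), Young's inequality with weight 1/c bounds 2 |<u(s) - u(t), g>|
   by two terms, each at most e. *)
pose c := e / (ipx g g + 1).
have g0 : 0 < ipx g g + 1 by rewrite ltr_wpDl// ip_ge0.
have c0 : 0 < c by rewrite divr_gt0.
have ce0 : 0 < Num.min c e by rewrite lt_min c0.
apply: filterS2 (Hs _ ce0) (withinT _ (nbhs_filter s)) => t.
rewrite sub0r normrN ger0_norm ?L2norm_ge0// => Lt tT.
have jt := H1L2_sqx tT; have js := H1L2_sqx sT.
have jd := sqintB mI js jt.
have := L2norm_ip (sqintB mI jt js).
have -> : L2norm l (u t \- u s) = L2norm l (fun x => u t x - u s x) by [].
have -> : ipx (u t \- u s) (u t \- u s) = ipx (u s \- u t) (u s \- u t).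
  by apply: eq_Rintegral => x _ /=; ring.
move=> LE.
rewrite -ipBl// -(ler_pM2l (x := 2))//.
apply: (le_trans (ip_young_norm mI (e := c^-1) _ jd jg)); first by rewrite invr_gt0.
rewrite invrK -LE.
have N0 : 0 <= L2norm l (fun x => u t x - u s x) := L2norm_ge0 _.
move: Lt; rewrite le_min => /andP[N1 N2].
have A1 : c^-1 * L2norm l (fun x => u t x - u s x) ^+ 2 <= e.
  by rewrite ler_pdivrMl// expr2 ler_pM.
have A2 : c * ipx g g <= e.
  by rewrite /c mulrAC ler_pdivrMr// ler_wpM2l ?(ltW e0)// lerDl.
by rewrite mulr_natl mulr2n; exact: lerD.
Qed.

Lemma H1L2_FTC s t (g : R -> R) : 0 <= s -> s < t -> t <= T -> sqx g ->
  ipx (u t) g - ipx (u s) g = \int[mu]_(r in `]s, t[) ipx (ut r) g.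
Proof.
move=> s0 st tT jg.
have stT : `]s, t[ `<=` J by apply: subset_itv; rewrite bnd_simp.
apply: (@weak_derivative_FTC R T s t (fun t => ipx (u t) g)) => //.
- apply: continuous_subspaceW (H1L2_weakly_continuous jg).
  by apply: subset_itv; rewrite bnd_simp.
- by apply: integrableS (ip_integrable_fixed H1L2_dt_sqQ jg).
move=> eta eta0 _.
have [seta _ _] := eta0.
have ceta : continuous eta by exact: (smooth_continuous (n := 0) seta).
have cdeta : continuous (derive1 eta).
  by have := smooth_continuous (n := 1) seta; rewrite derive1n1.
rewrite !ip_time_test//; [|exact: H1L2_dt_sqQ|exact: H1L2_sqQ].
have [_ _ weak _ _] := Hu.
have iw (v : R -> R -> R) (ee : R -> R) : sqQ (unc v) -> continuous ee ->
    measurable_fun I (fun x => (\int[mu]_(r in J) (v r x * ee r)) * g x).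
  move=> jv cee; apply: measurable_funM; last exact: jg.1.
  have := measurable_int _ (@fubini_integrable2 _ _ _ _ _ mu mu J I
    (fun z => v z.1 z.2 * ee z.1) mJ mI (integrable_test jv cee)).
  by move/measurable_EFinP.
rewrite -RintegralN; apply: ae_eq_Rintegral => //.
- exact: iw H1L2_sqQ cdeta.
- by apply: measurableT_comp => //; exact: iw H1L2_dt_sqQ ceta.
by apply: ae_mono (weak eta eta0) => x wx Ix; rewrite wx// mulNr.
Qed.

Let Z r := ipx (ut r) (ut r).

Let iZ : mu.-integrable J (EFin \o Z).
Proof. exact: ip_integrable H1L2_dt_sqQ H1L2_dt_sqQ. Qed.

Let itv_sub s t : 0 <= s -> t <= T -> `]s, t[ `<=` J.
Proof. by move=> s0 tT; apply: subset_itv; rewrite bnd_simp. Qed.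

Let mitv (s t : R) : @measurable _ RM (`]s, t[).
Proof. exact: measurable_itv. Qed.

Let integrable_sub_itv f s t : 0 <= s -> t <= T ->
  mu.-integrable J (EFin \o f) -> mu.-integrable `]s, t[ (EFin \o f).
Proof. move=> s0 tT; exact: integrableS mJ (mitv s t) (itv_sub s0 tT). Qed.

Let Rintegral_cst_itv (s t c : R) : s < t ->
  \int[mu]_(x in `]s, t[) c = (t - s) * c.
Proof.
move=> st; rewrite Rintegral_cst//= lebesgue_measure_itv/= lte_fin st.
by rewrite -EFinB/= mulrC.
Qed.

Let integrable_cst_itv (s t c : R) : mu.-integrable `]s, t[ (EFin \o (fun=> c)).
Proof.
have fin : (mu `]s, t[ < +oo)%E.
  by rewrite lebesgue_measure_itv/=; case: ifP => _; rewrite ?ltry.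
have jc k := @sqint_cst _ RM R mu _ (mitv s t) k fin.
by apply: integrable_ext (sqintM (mitv s t) (jc c) (jc 1)) => x /=; rewrite mulr1.
Qed.

(** The increment u(t) - u(s) does not depend on the integration variable, so it may itself serve as
    g in [H1L2_FTC]. Young's inequality with weight t - s then leaves half of its square norm on the
    right, to be absorbed. *)
Lemma H1L2_increment s t : 0 <= s -> s < t -> t <= T ->
  ipx (u t \- u s) (u t \- u s) <= (t - s) * \int[mu]_(r in `]s, t[) Z r.
Proof.
move=> s0 st tT; have ts : 0 < t - s by rewrite subr_gt0.
have jt : sqx (u t) by apply: H1L2_sqx; rewrite /= in_itv/= (le_trans s0 (ltW st)).
have js : sqx (u s) by apply: H1L2_sqx; rewrite /= in_itv/= s0 (le_trans (ltW st)).
have jd := sqintB mI jt js.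
set N := ipx _ _; set z := Rintegral _ _ _.
have : N = \int[mu]_(r in `]s, t[) ipx (ut r) (u t \- u s).
  by rewrite -(H1L2_FTC s0 st tT jd) -ipBl.
have iZ' := integrable_sub_itv s0 tT iZ.
have ic := integrable_cst_itv s t ((t - s)^-1 / 2 * N).
have iz2 := integrable_scale ((t - s) / 2) (mitv s t) iZ'.
have ig := integrable_add (mitv s t) iz2 ic.
have ip' := integrable_sub_itv s0 tT (ip_integrable_fixed H1L2_dt_sqQ jd).
have := ae_le_Rintegral (mitv s t) ip' ig.
rewrite (RintegralD (mitv s t) iz2 ic) RintegralZl// Rintegral_cst_itv// => H E.
have : N <= (t - s) / 2 * z + (t - s) * ((t - s)^-1 / 2 * N).
  rewrite {1}E; apply: H; apply: ae_mono (ae_section_sqx H1L2_dt_sqQ) => r jr rst.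
  have {}jr := jr (itv_sub s0 tT rst).
  by have := ip_young mI ts jr jd; rewrite -/(Z r) -/N; nra.
rewrite (_ : (t - s) * (_ / 2 * N) = N / 2); last by field; rewrite gt_eqF.
by move=> ?; lra.
Qed.

Let P r := ipx (ut r) (u r).

Let iP : mu.-integrable J (EFin \o P).
Proof. exact: ip_integrable H1L2_dt_sqQ H1L2_sqQ. Qed.

(** By convexity |u(t)|^2 - |u(s)|^2 <= 2 <u(t) - u(s), u(t)>, which is twice the integral of
    <ut(r), u(t)>. Replacing u(t) by u(r) costs <ut(r), u(t) - u(r)>, and [H1L2_increment] shows
    that this integrates to at most (t - s) times the integral of |ut|^2. *)
Lemma H1L2_energy_step s t : 0 <= s -> s < t -> t <= T ->
  ipx (u t) (u t) - ipx (u s) (u s) <=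
  2 * \int[mu]_(r in `]s, t[) P r
  + 2 * (t - s) * \int[mu]_(r in `]s, t[) Z r.
Proof.
move=> s0 st tT; have ts : 0 < t - s by rewrite subr_gt0.
have jt : sqx (u t) by apply: H1L2_sqx; rewrite /= in_itv/= (le_trans s0 (ltW st)).
have js : sqx (u s) by apply: H1L2_sqx; rewrite /= in_itv/= s0 (le_trans (ltW st)).
have jd := sqintB mI jt js.
set z := \int[mu]_(r in `]s, t[) Z r.
have E1 : ipx (u t) (u t) - ipx (u s) (u s) <=
    2 * \int[mu]_(r in `]s, t[) ipx (ut r) (u t).
  have := ip_ge0 mu I (u t \- u s); rewrite -(H1L2_FTC s0 st tT jt).
  by rewrite ipBl// !ipBr// (ipC mu I (u s) (u t)); lra.
apply: (le_trans E1).
have iZ' := integrable_sub_itv s0 tT iZ.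
have iP' := integrable_sub_itv s0 tT iP.
have ic := integrable_cst_itv s t (z / 2).
have iz2 := integrable_scale ((t - s) / 2) (mitv s t) iZ'.
have izc := integrable_add (mitv s t) iz2 ic.
have ig := integrable_add (mitv s t) iP' izc.
have ip' := integrable_sub_itv s0 tT (ip_integrable_fixed H1L2_dt_sqQ jt).
have := ae_le_Rintegral (mitv s t) ip' ig.
rewrite RintegralD// RintegralD// RintegralZl// Rintegral_cst_itv// -/z => H.
have : \int[mu]_(r in `]s, t[) ipx (ut r) (u t) <=
    \int[mu]_(r in `]s, t[) P r + ((t - s) / 2 * z + (t - s) * (z / 2)).
  apply: H; apply: ae_mono (ae_section_sqx H1L2_dt_sqQ) => r jr rst.
  have {}jr := jr (itv_sub s0 tT rst).
  have /andP[sr rt] : s < r < t by move: rst; rewrite /= in_itv.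
  have r0 : 0 <= r by exact: le_trans (ltW sr).
  have jur : sqx (u r) by apply: H1L2_sqx; rewrite /= in_itv/= r0 (le_trans (ltW rt)).
  have jdr := sqintB mI jt jur.
  have -> : ipx (ut r) (u t) = P r + ipx (ut r) (u t \- u r).
    by rewrite ipBr// /P; ring.
  rewrite lerD2l.
  have N := H1L2_increment r0 rt tT.
  have zr : \int[mu]_(x in `]r, t[) Z x <= z.
    rewrite Rintegral_mkcond /z [leRHS]Rintegral_mkcond.
    have Z0 x : 0 <= Z x := ip_ge0 _ _ _.
    have sub : `]r, t[ `<=` `]s, t[ by apply: subset_itv; rewrite bnd_simp// ltW.
    apply: le_Rintegral => //.
    - rewrite -restrict_EFin; apply/(integrable_mkcond _ (mitv r t)).
      exact: integrableS (mitv s t) (mitv r t) sub iZ'.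
    - by rewrite -restrict_EFin; exact/(integrable_mkcond _ (mitv s t)).
    - move=> x _; rewrite !patchE; case: ifPn => [/set_mem/sub/mem_set ->//|_].
      by case: ifP.
  have z0 : 0 <= \int[mu]_(x in `]r, t[) Z x.
    by apply: Rintegral_ge0 => x _; exact: ip_ge0.
  have Nz : ipx (u t \- u r) (u t \- u r) <= (t - s) * z.
    apply: (le_trans N); apply: ler_pM => //; first by rewrite subr_ge0 ltW.
    by rewrite lerD2l lerN2 ltW.
  have Y := ip_young mI ts jr jdr.
  have : (t - s)^-1 * ipx (u t \- u r) (u t \- u r) <= z.
    by rewrite ler_pdivrMl.
  by move: Y; rewrite -/(Z r); lra.
have aux (a b c e : R) : a <= b + (c / 2 * e + c * (e / 2)) ->
    2 * a <= 2 * b + 2 * c * e by lra.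
exact: aux.
Qed.

Let itv_add (f : R -> R) s t : 0 <= s -> s < t -> t <= T ->
  mu.-integrable J (EFin \o f) ->
  \int[mu]_(r in `]0, t[) f r =
  \int[mu]_(r in `]0, s[) f r + \int[mu]_(r in `]s, t[) f r.
Proof.
move=> s0 st tT jf.
have jt := integrable_sub_itv (lexx 0) tT jf.
have -> : \int[mu]_(r in `]0, s[) f r = \int[mu]_(r in `]0, s]) f r.
  apply: Rintegral_itv_bndo_bndc.
  exact: integrable_sub_itv (lexx 0) (le_trans (ltW st) tT) jf.
have E : `]0, t[%classic = `]0, s] `|` `]s, t[ :> set R.
  by rewrite -itv_bndbnd_setU// bnd_simp.
rewrite E Rintegral_setU//; first by rewrite -E.
apply/disj_setPS => x [/=]; rewrite !in_itv/= => /andP[_ xs] /andP[sx _].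
by have := le_lt_trans xs sx; rewrite ltxx.
Qed.

(** Stands for the product rule (|u|^2)' = 2 <ut, u>, as an inequality: the one-step estimates
    telescope, and their errors carry the mesh as an extra factor. *)
Lemma H1L2_energy t : 0 < t -> t <= T ->
  ipx (u t) (u t) <=
  ipx (u 0) (u 0) + 2 * \int[mu]_(r in `]0, t[) P r.
Proof.
move=> t0 tT.
pose A s := \int[mu]_(r in `]0, s[) P r.
pose B s := \int[mu]_(r in `]0, s[) Z r.
have A0 : A 0 = 0 by rewrite /A set_itvoo0 Rintegral_set0.
have B0 : B 0 = 0 by rewrite /B set_itvoo0 Rintegral_set0.
have step_ab s s' : 0 <= s -> s < s' -> s' <= T ->
    ipx (u s') (u s') - ipx (u s) (u s) <=
    2 * (A s' - A s) + 2 * (s' - s) * (B s' - B s).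
  move=> s0 ss' s'T; apply: (le_trans (H1L2_energy_step s0 ss' s'T)).
  rewrite /A /B (itv_add s0 ss' s'T iP) (itv_add s0 ss' s'T iZ).
  have aux (a b c d e : R) :
      2 * a + e * b <= 2 * (c + a - c) + e * (d + b - d).
    by rewrite (addrC c) addrK (addrC d) addrK.
  exact: aux.
(* Summing over the subdivision of mesh t/n leaves an error of size B(t)/n. *)
have tele n : ipx (u t) (u t) - ipx (u 0) (u 0) <=
    2 * A t + 2 * (t / n.+1%:R) * B t.
  pose h := t / n.+1%:R; have h0 : 0 < h by rewrite divr_gt0.
  have nh : n.+1%:R * h = t by rewrite /h mulrC divfK.
  have H k : (k <= n.+1)%N -> ipx (u (k%:R * h)) (u (k%:R * h)) - ipx (u 0) (u 0)
      <= 2 * A (k%:R * h) + 2 * h * B (k%:R * h).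
    elim: k => [|k IH] kn; first by rewrite mul0r subrr A0 B0 !mulr0 addr0.
    have k1 : k.+1%:R * h <= T by rewrite (le_trans _ tT)// -nh ler_pM2r// ler_nat.
    have kk : k%:R * h < k.+1%:R * h by rewrite ltr_pM2r// ltr_nat.
    have := step_ab _ _ (mulr_ge0 (ler0n _ k) (ltW h0)) kk k1.
    have -> : k.+1%:R * h - k%:R * h = h by rewrite -mulrBl -natrB ?subSnn ?mul1r.
    have := IH (ltnW kn).
    have aux (a b c d e f g i j : R) : a - b <= 2 * d + 2 * h * e ->
      c - a <= 2 * (f - d) + 2 * h * (g - e) -> c - b <= 2 * f + 2 * h * g by lra.
    exact: aux.
  by have := H n.+1 (leqnn _); rewrite nh.
rewrite -lerBlDl leNgt; apply/negP => lt_A.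
pose D := ipx (u t) (u t) - ipx (u 0) (u 0) - 2 * A t.
have D0 : 0 < D by rewrite /D subr_gt0.
(* If the inequality failed by D > 0, a subdivision into more than 2 t B(t) / D steps would have a
   total error below D. *)
have := tele (Num.truncn (2 * t * B t / D)).
set n := (Num.truncn _).+1.
have : 2 * t * B t / D < n%:R by apply: truncnS_gt.
rewrite ltr_pdivrMr// => H1 H2.
have n0 : (0 : R) < n%:R by rewrite ltr0n.
have : D <= 2 * (t / n%:R) * B t by rewrite /D lerBlDl.
rewrite -(ler_pM2l n0) (_ : n%:R * (2 * _ * _) = 2 * t * B t).
  by rewrite leNgt H1.
by field; rewrite gt_eqF.
Qed.

End H1L2.

(** * Linear combinations, a Gronwall estimate and the bound on source terms *)

Section energy_bounds.
Context {R : realType}.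
Local Notation mu := (@lebesgue_measure R).
Variables (l T : R).
Hypotheses (l0 : 0 < l) (T0 : 0 < T).
Local Notation I := (`]0, l[%classic : set R).
Local Notation J := (`]0, T[%classic : set R).
Local Notation RM := (measurableTypeR R).
Local Notation Q := (J `*` I).
Local Notation mQ := (mu \x mu)%E.
Local Notation unc v := (fun z : R * R => v z.1 z.2).
Local Notation sqx := (sqint mu I).
Local Notation sqQ := (sqint mQ Q).
Local Notation ipx := (ip mu I).

Let mI : @measurable _ RM I. Proof. exact: measurable_itv. Qed.
Let mJ : @measurable _ RM J. Proof. exact: measurable_itv. Qed.
Let mJI : @measurable _ (RM * RM)%type Q. Proof. exact: measurableX. Qed.

Lemma L2norm_le (f : R -> R) (e : R) : 0 <= e -> sqx f ->
  (L2norm l f <= e) = (ipx f f <= e ^+ 2).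
Proof.
by move=> e0 jf; rewrite -L2norm_ip// ler_sqr ?nnegrE// L2norm_ge0.
Qed.

Lemma inH1L2_comb (c : R) (u ut w wt : R -> R -> R) :
  inH1L2 l T u ut -> inH1L2 l T w wt ->
  inH1L2 l T (fun t x => u t x + c * w t x) (fun t x => ut t x + c * wt t x).
Proof.
move=> Hu Hw.
have ju := H1L2_sqQ Hu; have jw := H1L2_sqQ Hw.
have jut := H1L2_dt_sqQ Hu; have jwt := H1L2_dt_sqQ Hw.
have comb t : `[0, T] t -> sqx (fun x => u t x + c * w t x).
  move=> tT; have jut' := H1L2_sqx Hu tT; have jwt' := H1L2_sqx Hw tT.
  exact: (@sqintD _ _ _ mu I mI (u t) (c \*o w t) jut' (sqintZ mI c jwt')).
split.
- apply/inL2Q_sqint.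
  exact: (@sqintD _ _ _ mQ Q mJI (unc u) (c \*o unc w) ju (sqintZ mJI c jw)).
- apply/inL2Q_sqint.
  exact: (@sqintD _ _ _ mQ Q mJI (unc ut) (c \*o unc wt) jut (sqintZ mJI c jwt)).
- move=> eta eta0; have [seta _ _] := eta0.
  have ceta : continuous eta by exact: (smooth_continuous (n := 0) seta).
  have cdeta : continuous (derive1 eta).
    by have := smooth_continuous (n := 1) seta; rewrite derive1n1.
  have split_int (v z : R -> R -> R) (ee : R -> R) : sqQ (unc v) -> sqQ (unc z) ->
      continuous ee -> {ae mu, forall x, I x ->
      \int[mu]_(t in J) ((v t x + c * z t x) * ee t) =
      \int[mu]_(t in J) (v t x * ee t) + c * \int[mu]_(t in J) (z t x * ee t)}.
    move=> jv jz cee.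
    have iv := @fubini_ae_integrable2 _ _ _ _ _ mu mu J I _ mJ mI (integrable_test jv cee).
    have iz := @fubini_ae_integrable2 _ _ _ _ _ mu mu J I _ mJ mI (integrable_test jz cee).
    apply: ae_mono (ae_and iv iz) => x [ivx izx] Ix.
    have {}ivx : mu.-integrable J (EFin \o (fun t => v t x * ee t)) := ivx Ix.
    have {}izx : mu.-integrable J (EFin \o (fun t => z t x * ee t)) := izx Ix.
    rewrite -(RintegralZl c mJ izx) -(RintegralD mJ ivx (integrable_scale c mJ izx)).
    by apply: eq_Rintegral => t _; rewrite mulrDl mulrA.
  have [_ _ /(_ _ eta0) wu _ _] := Hu; have [_ _ /(_ _ eta0) ww _ _] := Hw.
  apply: ae_mono (ae_and (ae_and wu ww)
    (ae_and (split_int _ _ _ ju jw cdeta) (split_int _ _ _ jut jwt ceta))).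
  move=> x [[wux wwx] [s1 s2]] Ix.
  by rewrite s1// s2// wux// wwx// mulrN opprD.
- by move=> t tT; exact/inL2_sqint/comb.
- move=> s sT; apply/cvgrPdist_le => e e0.
  have [_ _ _ _ /(_ s sT) /cvgrPdist_le Hus] := Hu.
  have [_ _ _ _ /(_ s sT) /cvgrPdist_le Hws] := Hw.
  have e2 : 0 < e / 2 by rewrite divr_gt0.
  have c1 : 0 < `|c| + 1 by rewrite ltr_wpDl.
  (* This radius times |c| is at most e/2; adding 1 covers c = 0. *)
  have ec : 0 < e / 2 / (`|c| + 1) by rewrite divr_gt0.
  apply: filterS3 (Hus _ e2) (Hws _ ec) (withinT _ (nbhs_filter s)) => t.
  have N0 f : `|0 - L2norm l f| = L2norm l f.
    by rewrite sub0r normrN ger0_norm ?L2norm_ge0.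
  rewrite !N0 => Lu Lw tT.
  have jdu := sqintB mI (H1L2_sqx Hu tT) (H1L2_sqx Hu sT).
  have jdw := sqintB mI (H1L2_sqx Hw tT) (H1L2_sqx Hw sT).
  have jd := sqintB mI (comb _ tT) (comb _ sT).
  have {}Lu : ipx (u t \- u s) (u t \- u s) <= (e / 2) ^+ 2.
    by rewrite -L2norm_le ?(ltW e2).
  have {}Lw : ipx (w t \- w s) (w t \- w s) <= (e / 2 / (`|c| + 1)) ^+ 2.
    by rewrite -L2norm_le ?(ltW ec).
  rewrite (L2norm_le (ltW e0) jd).
  set du := u t \- u s in jdu Lu *; set dw := w t \- w s in jdw Lw *.
  have jcw := sqintZ mI c jdw.
  rewrite (@eq_ip _ _ _ mu I _ (du \+ c \*o dw) _ (du \+ c \*o dw)); last 2 first.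
  - by move=> x _; rewrite /du /dw /=; ring.
  - by move=> x _; rewrite /du /dw /=; ring.
  have js := sqintD mI jdu jcw.
  rewrite (ipDl mI jdu jcw js) (ipDr mI jdu jcw jdu) (ipDr mI jdu jcw jcw).
  rewrite [X in _ + (X + _)]ipC.
  have Y := ip_young mI ltr01 jdu jcw; rewrite invr1 !mul1r in Y.
  have C : ipx (c \*o dw) (c \*o dw) <= (e / 2) ^+ 2.
    rewrite ipZl// ipZr// mulrA -expr2 -(real_normK (num_real c)).
    apply: (@le_trans _ _ (`|c| ^+ 2 * (e / 2 / (`|c| + 1)) ^+ 2)).
      by rewrite ler_wpM2l ?sqr_ge0.
    rewrite -exprMn ler_sqr ?nnegrE; last 2 first.
    - by rewrite mulr_ge0// ltW.
    - exact: ltW.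
    rewrite mulrCA ler_piMr ?(ltW e2)// ler_pdivrMr// mul1r lerDl.
    exact: ler01.
  have aux1 (x y z : R) : 2 * y <= x + z -> x + y + (y + z) <= 2 * x + 2 * z by lra.
  have aux2 (x y z : R) : x <= z -> y <= z -> 2 * x + 2 * y <= z + z + (z + z) by lra.
  rewrite (_ : e ^+ 2 = (e / 2) ^+ 2 + (e / 2) ^+ 2 + ((e / 2) ^+ 2 + (e / 2) ^+ 2)).
    apply: (@le_trans _ _ (2 * ipx du du + 2 * ipx (c \*o dw) (c \*o dw))).
      exact: (aux1 _ _ _ Y).
    exact: aux2.
  by field.
Qed.

Lemma energy_bound (w wt : R -> R -> R) (G : R -> R) : inH1L2 l T w wt ->
  mu.-integrable J (EFin \o G) ->
  {ae mu, forall r, J r -> 2 * ipx (wt r) (w r) <= G r} ->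
  forall t, 0 < t -> t <= T ->
  ipx (w t) (w t) <= ipx (w 0) (w 0) + \int[mu]_(r in `]0, t[) G r.
Proof.
move=> Hw iG HG t t0 tT; apply: (le_trans (H1L2_energy Hw t0 tT)).
have sub : `]0, t[ `<=` J by apply: subset_itv; rewrite bnd_simp.
have mt : @measurable _ RM `]0, t[ by exact: measurable_itv.
have iP := integrableS mJ mt sub
  (ip_integrable (H1L2_dt_sqQ Hw) (H1L2_sqQ Hw)).
rewrite lerD2l -RintegralZl//; apply: ae_le_Rintegral => //.
- exact: integrable_scale.
- exact: integrableS mJ mt sub iG.
- by apply: ae_mono HG => r Hr rt; apply: Hr; exact: sub.
Qed.

(** The rate 1/(2T) is matched to the length of the interval. With S the integral of |w|^2 over (0,
    T), one integration gives |w(t)|^2 <= T K + S/(2T), and a second S <= T^2 K + S/2. Absorbing S/2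
    keeps all constants explicit, without an exponential. *)
Lemma energy_gronwall (w wt : R -> R -> R) (K : R) : inH1L2 l T w wt ->
  0 <= K -> ipx (w 0) (w 0) = 0 ->
  {ae mu, forall r, J r ->
    2 * ipx (wt r) (w r) <= K + (2 * T)^-1 * ipx (w r) (w r)} ->
  forall t, `[0, T] t -> ipx (w t) (w t) <= 2 * T * K.
Proof.
move=> Hw K0 w0 HG.
have jw := H1L2_sqQ Hw.
have iE := ip_integrable jw jw.
have iK : mu.-integrable J (EFin \o (fun=> K)).
  have fin : (mu J < +oo)%E := itv0_finite T.
  have jc k := @sqint_cst _ RM R mu _ mJ k fin.
  by apply: integrable_ext (sqintM mJ (jc K) (jc 1)) => x /=; rewrite mulr1.
have iE' := integrable_scale (2 * T)^-1 mJ iE.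
have iG := integrable_add mJ iK iE'.
pose S := \int[mu]_(r in J) ipx (w r) (w r).
have S0 : 0 <= S by apply: Rintegral_ge0 => r _; exact: ip_ge0.
have TK (t : R) : 0 < t -> \int[mu]_(r in `]0, t[) K = t * K.
  move=> t0; rewrite Rintegral_cst//= lebesgue_measure_itv/= lte_fin t0.
  by rewrite sube0/= mulrC.
have T20 : 0 < (2 * T)^-1 by rewrite invr_gt0 mulr_gt0.
have B t : `[0, T] t -> ipx (w t) (w t) <= T * K + (2 * T)^-1 * S.
  rewrite /= in_itv/= => /andP[]; rewrite le_eqVlt => /predU1P[<- _|t0 tT].
    by rewrite w0 addr_ge0// mulr_ge0// ltW.
  apply: (le_trans (energy_bound Hw iG HG t0 tT)); rewrite w0 add0r.
  have sub : `]0, t[ `<=` J by apply: subset_itv; rewrite bnd_simp.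
  have mt : @measurable _ RM `]0, t[ by exact: measurable_itv.
  apply: (@le_trans _ _ (\int[mu]_(r in J) (K + (2 * T)^-1 * ipx (w r) (w r)))).
    rewrite Rintegral_mkcond [leRHS]Rintegral_mkcond.
    apply: le_Rintegral => //.
    - rewrite -restrict_EFin; apply/(integrable_mkcond _ mt).
      exact: integrableS mJ mt sub iG.
    - by rewrite -restrict_EFin; exact/(integrable_mkcond _ mJ).
    - move=> x _; rewrite !patchE; case: ifPn => [/set_mem/sub/mem_set ->//|_].
      by case: ifP => // _; rewrite addr_ge0// mulr_ge0 ?ip_ge0// ltW.
  by rewrite (RintegralD mJ iK iE') TK// (RintegralZl _ mJ iE).
have iB : mu.-integrable J (EFin \o (fun=> T * K + (2 * T)^-1 * S)).
  have fin : (mu J < +oo)%E := itv0_finite T.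
  have jc k := @sqint_cst _ RM R mu _ mJ k fin.
  apply: integrable_ext (sqintM mJ (jc (T * K + (2 * T)^-1 * S)) (jc 1)) => x /=.
  by rewrite mulr1.
have SB : S <= T * (T * K + (2 * T)^-1 * S).
  apply: (@le_trans _ _ (\int[mu]_(r in J) (T * K + (2 * T)^-1 * S))).
    by apply: le_Rintegral => // r rJ; apply: B; exact: subset_itv_oo_cc rJ.
  rewrite Rintegral_cst//= lebesgue_measure_itv/= lte_fin T0.
  by rewrite sube0/= mulrC.
have SB2 : (2 * T)^-1 * S <= T * K.
  rewrite ler_pdivrMl; last by rewrite mulr_gt0.
  move: SB; rewrite mulrDr (_ : T * (_^-1 * S) = S / 2); last first.
    by field; rewrite gt_eqF.
  by move=> SB; rewrite -[2 * T * _]mulrA; lra.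
move=> t /B; move: SB2; rewrite -[2 * T * _]mulrA; lra.
Qed.

(** [F] is the zero-order term of the equation for [w]. The hypothesis expresses that, once its part
    of favourable sign is discarded, a source of size at most k |z| remains. Taking e = 2T makes 1/e
    the rate required by [energy_gronwall]. *)
Lemma ip_source_bound (F w z : R -> R) (k e : R) : 0 < e ->
  sqx F -> sqx w -> sqx z ->
  (forall x, I x -> - (F x * w x) <= k * `|z x| * `|w x|) ->
  - (2 * ipx F w) <= e * k ^+ 2 * ipx z z + e^-1 * ipx w w.
Proof.
move=> e0 jF jw jz H.
have jn f : sqx f -> sqx (fun x => `|f x|).
  move=> [mf jf]; apply: (@sqint_le _ _ _ mu I mI (fun x => `|f x|) f) => //.
    exact: measurableT_comp.
  by move=> x _; rewrite real_normK ?num_real.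
have nn f : ipx (fun x => `|f x|) (fun x => `|f x|) = ipx f f.
  by apply: eq_Rintegral => x _; rewrite -!expr2 real_normK ?num_real.
have jkz := sqintZ mI k (jn _ jz).
have jF' := sqintZ mI (-1) jF.
have : ipx (-1 \*o F) w <= ipx (k \*o (fun x => `|z x|)) (fun x => `|w x|).
  by apply: ip_le => // [|x Ix /=]; [exact: jn|rewrite mulN1r mulNr; exact: H].
rewrite ipZl// mulN1r => A.
have := ip_young mI e0 jkz (jn _ jw); rewrite nn.
rewrite [ipx (k \*o _) (k \*o _)]ipZl//; last exact: jn.
rewrite ipZr//; [|exact: jn|exact: jn]; rewrite nn => B.
rewrite -mulrN; apply: (le_trans (ler_wpM2l _ A)) => //.
by rewrite (_ : e * k ^+ 2 * ipx z z = e * (k * (k * ipx z z)))//; ring.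
Qed.

End energy_bounds.

(** * Estimates for the states *)

Section states.
Context {R : realType}.
Local Notation mu := (@lebesgue_measure R).
Variables (l T : R).
Hypotheses (l0 : 0 < l) (T0 : 0 < T).
Local Notation I := (`]0, l[%classic : set R).
Local Notation J := (`]0, T[%classic : set R).
Local Notation RM := (measurableTypeR R).
Local Notation Q := (J `*` I).
Local Notation mQ := (mu \x mu)%E.
Local Notation unc v := (fun z : R * R => v z.1 z.2).
Local Notation sqx := (sqint mu I).
Local Notation sqQ := (sqint mQ Q).
Local Notation ipx := (ip mu I).

Let mI : @measurable _ RM I. Proof. exact: measurable_itv. Qed.
Let mJ : @measurable _ RM J. Proof. exact: measurable_itv. Qed.
Let mJI : @measurable _ (RM * RM)%type Q. Proof. exact: measurableX. Qed.

(* The weak equation tested with g; s and s' are the fluxes, i.e. the spatial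
   gradients of the solution and of g multiplied by sqrt a. *)
Definition weq (f s F g s' : R -> R) : Prop :=
  ipx f g + ipx s s' + ipx F g = 0.

Let linear_comb (c x1 y1 z1 x2 y2 z2 : R) : x1 + y1 + z1 = 0 ->
  x2 + y2 + z2 = 0 -> x1 + c * x2 + (y1 + c * y2) + (z1 + c * z2) = 0.
Proof.
move=> E1 E2; rewrite (_ : _ + (z1 + _) = x1 + y1 + z1 + c * (x2 + y2 + z2)).
  by rewrite E1 E2 mulr0 addr0.
by ring.
Qed.

Lemma weq_combl (c : R) (f1 s1 F1 f2 s2 F2 g s' : R -> R) :
  sqx f1 -> sqx s1 -> sqx F1 -> sqx f2 -> sqx s2 -> sqx F2 -> sqx g -> sqx s' ->
  weq f1 s1 F1 g s' -> weq f2 s2 F2 g s' ->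
  weq (f1 \+ c \*o f2) (s1 \+ c \*o s2) (F1 \+ c \*o F2) g s'.
Proof.
move=> jf1 js1 jF1 jf2 js2 jF2 jg js' E1 E2; rewrite /weq.
have cf := sqintZ mI c jf2; have cs := sqintZ mI c js2; have cF := sqintZ mI c jF2.
rewrite (ipDl mI jf1 cf jg) (ipDl mI js1 cs js') (ipDl mI jF1 cF jg).
rewrite (ipZl mI c jf2 jg) (ipZl mI c js2 js') (ipZl mI c jF2 jg).
exact: linear_comb.
Qed.

(** Together with [weq_combl]: every test function actually inserted is one of the states, which
    lies in [inH1a] by the definition of a solution. Bilinearity then yields the equation of a
    combination of states tested with that same combination. *)
Lemma weq_combr (c : R) (f s F g1 s1 g2 s2 : R -> R) :
  sqx f -> sqx s -> sqx F -> sqx g1 -> sqx s1 -> sqx g2 -> sqx s2 ->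
  weq f s F g1 s1 -> weq f s F g2 s2 ->
  weq f s F (g1 \+ c \*o g2) (s1 \+ c \*o s2).
Proof.
move=> jf js jF jg1 js1 jg2 js2 E1 E2; rewrite /weq.
have cg := sqintZ mI c jg2; have cs := sqintZ mI c js2.
rewrite (ipDr mI jg1 cg jf) (ipDr mI js1 cs js) (ipDr mI jg1 cg jF).
rewrite (ipZr mI c jg2 jf) (ipZr mI c js2 js) (ipZr mI c jg2 jF).
exact: linear_comb.
Qed.

(** The diffusion term is the square norm of the flux and drops out by its sign. *)
Lemma weq_le (f s F g : R -> R) (B : R) :
  weq f s F g s -> - (2 * ipx F g) <= B -> 2 * ipx f g <= B.
Proof. by move=> E; have := ip_ge0 mu I s; move: E; rewrite /weq; lra. Qed.

Lemma ip_ae_bound (f : R -> R) (c : R) : sqx f ->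
  {ae mu, forall x, I x -> `|f x| <= c} -> ipx f f <= c ^+ 2 * l.
Proof.
move=> jf fc.
have -> : c ^+ 2 * l = \int[mu]_(x in I) (c ^+ 2).
  by rewrite Rintegral_cst//= lebesgue_measure_itv/= lte_fin l0 sube0.
have jc k := @sqint_cst _ RM R mu _ mI k (itv0_finite l).
apply: ae_le_Rintegral => //; first exact: sqintM.
  by apply: integrable_ext (sqintM mI (jc c) (jc c)) => x /=; rewrite expr2.
apply: ae_mono fc => x H Ix; have {}H := H Ix.
by rewrite -expr2 -(real_normK (num_real (f x))) ler_sqr ?nnegrE// (le_trans _ H).
Qed.

Lemma ip_ae_eq0 (f : R -> R) : sqx f ->
  {ae mu, forall x, I x -> f x = 0} -> ipx f f = 0.
Proof.
move=> jf f0; apply/le_anti; rewrite ip_ge0 andbT.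
have := @ip_ae_bound f 0 jf; rewrite expr0n/= mul0r; apply.
by apply: ae_mono f0 => x H Ix; rewrite H// normr0.
Qed.

Variable a : R -> R.
Hypothesis ma : measurable_fun I a.
Hypothesis a_gt0 : forall x, I x -> 0 < a x.

Local Notation flux ux t := (fun x => Num.sqrt (a x) * ux t x).

(** As a may degenerate at the end points, the weighted space controls sqrt(a) ux and not ux; hence
    the diffusion term is treated as an inner product of fluxes. *)
Lemma flux_sqx (u ux : R -> R -> R) : inL2H1a a l T u ux ->
  {ae mu, forall t, J t -> sqx (flux ux t)}.
Proof.
move=> [mu_ mux _ foo].
have ma2 : measurable_fun Q (fun z : R * R => a z.2).
  exact: (@measurable_snd_dom _ _ RM RM R J I mJ mI a ma).
have mF : measurable_fun Q (fun z : R * R => a z.2 * ux z.1 z.2 ^+ 2).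
  by apply: measurable_funM => //; exact: measurable_funX.
have iF : mQ.-integrable Q (EFin \o (fun z : R * R => a z.2 * ux z.1 z.2 ^+ 2)).
  apply/integrableP; split; first exact/measurable_EFinP.
  apply: le_lt_trans foo; apply: ge0_le_integral => //.
  - by apply/measurable_EFinP; exact: measurableT_comp.
  - apply/measurable_EFinP; apply: measurable_funM => //.
    by apply: measurable_funD; exact: measurable_funX.
  - move=> z [_ /a_gt0 az] /=; rewrite lee_fin ger0_norm.
      by rewrite ler_wpM2l ?(ltW az)// lerDr sqr_ge0.
    by rewrite mulr_ge0 ?sqr_ge0// ltW.
have H := @fubini_ae_integrable _ _ _ _ _ mu mu J I _ mJ mI iF.
apply: ae_mono H => t H Jt; split.
  apply: measurable_funM.
    apply: (measurableT_comp _ ma).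
    by apply: continuous_measurable_fun; exact: sqrt_continuous.
  exact: (@measurable_section1 _ _ RM RM R J I mJ mI (unc ux) t Jt mux).
apply: eq_integrable (H Jt) => //.
move=> x /set_mem/a_gt0 ax /=.
by rewrite exprMn sqr_sqrtr// ltW.
Qed.

Definition bounded_coef (q : R -> R) (beta : R) : Prop :=
  measurable_fun I q /\ forall x, I x -> 0 <= q x <= beta.

Lemma coef_sqx (q v : R -> R) (beta : R) : bounded_coef q beta -> sqx v ->
  sqx (q \* v).
Proof.
move=> [mq qb] jv; apply: (@sqint_mull _ _ _ mu I mI beta) => // x /qb/andP[q0 q1].
by rewrite ger0_norm.
Qed.

(** The weak formulation in terms of inner products. [state_good] collects, for almost every t, what
    makes the slice u(t) usable as a test function in its own equation. *)
Record state (phi q : R -> R) (u ut ux : R -> R -> R) : Prop := State {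
  state_H1L2 : inH1L2 l T u ut ;
  state_init : {ae mu, forall x, I x -> u 0 x = phi x} ;
  state_good : {ae mu, forall t, J t -> [/\ sqx (u t), sqx (ut t),
    sqx (flux ux t) & inH1a a l (u t) (ux t)]} ;
  state_eq : {ae mu, forall t, J t -> forall psi dpsi, inL2 l psi ->
    inH1a a l psi dpsi ->
    weq (ut t) (flux ux t) (q \* u t) psi (fun x => Num.sqrt (a x) * dpsi x)} }.

Lemma weak_solution_state (phi q : R -> R) (u : R -> R -> R) :
  weak_solution a phi l T q u -> exists ut ux, state phi q u ut ux.
Proof.
move=> [ut [ux [Hu Hx Hi He]]]; exists ut, ux; split => //.
  have [_ _ H1 _] := Hx.
  have jt := ae_section_sqx (H1L2_dt_sqQ Hu).
  apply: ae_mono (ae_and (ae_and H1 (flux_sqx Hx)) jt) => t [[h1 h2] h3] Jt.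
  split; [|exact: h3|exact: h2|exact: h1].
  by apply: (H1L2_sqx Hu); exact: subset_itv_oo_cc Jt.
apply: ae_mono He => t H Jt psi dpsi jpsi hpsi.
apply: etrans (H (subset_itv_oo_oc Jt) _ _ jpsi hpsi); rewrite /weq /ip.
congr (_ + _ + _).
apply: eq_Rintegral => x /set_mem/a_gt0 ax.
rewrite mulrACA -expr2 sqr_sqrtr ?(ltW ax)//; exact: mulrA.
Qed.

Variables (phi : R -> R) (M beta : R).
Hypothesis phiM : forall x, I x -> 0 <= phi x <= M.

(** Tested with the solution itself, the diffusion term and q u^2 are nonnegative, so the norm never
    exceeds its initial value. An L^2 bound on the states suffices later because q1 - q2 is bounded
    uniformly. *)
Lemma state_bound (q : R -> R) (u ut ux : R -> R -> R) t : bounded_coef q beta ->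
  state phi q u ut ux -> `[0, T] t -> ipx (u t) (u t) <= M ^+ 2 * l.
Proof.
move=> qb [Hu Hi Hg He].
have z0 : `[0, T] 0 by rewrite /= in_itv/= lexx ltW.
have B0 : ipx (u 0) (u 0) <= M ^+ 2 * l.
  have ju0 := H1L2_sqx Hu z0.
  apply: (ip_ae_bound ju0).
  apply: ae_mono Hi => x H Ix; rewrite H//.
  by have /andP[p0 pM] := phiM Ix; rewrite ger0_norm.
rewrite /= in_itv/= => /andP[]; rewrite le_eqVlt => /predU1P[<- _ //|t0 tT].
have i0 : mu.-integrable J (EFin \o (fun=> 0 : R)).
  have jc k := @sqint_cst _ RM R mu _ mJ k (itv0_finite T).
  by apply: integrable_ext (sqintM mJ (jc 0) (jc 1)) => x /=; rewrite mul0r.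
have H : {ae mu, forall r, J r -> 2 * ipx (ut r) (u r) <= 0}.
  apply: ae_mono (ae_and Hg He) => r [hg he] Jr; have [ju jut js hu] := hg Jr.
  apply: (weq_le (he Jr _ _ ((inL2_sqint _ _).2 ju) hu)).
  rewrite oppr_le0 mulr_ge0//; apply: Rintegral_ge0 => x Ix /=.
  have /andP[q0 _] := qb.2 x Ix.
  by rewrite -mulrA mulr_ge0// -expr2 sqr_ge0.
have := energy_bound Hu i0 H t0 tT.
rewrite [X in _ + X](_ : _ = 0); last by rewrite /Rintegral integral0.
by rewrite addr0 => /le_trans; exact.
Qed.

Variables (q1 q2 p : R -> R) (k : R) (u1 ut1 ux1 u2 ut2 ux2 um utm uxm : R -> R -> R).
Hypotheses (bq1 : bounded_coef q1 beta) (bq2 : bounded_coef q2 beta)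
           (bp : bounded_coef p beta).
Hypotheses (pE : forall x, I x -> p x = (q1 x + q2 x) / 2).
Hypotheses (qk : forall x, I x -> `|q1 x - q2 x| <= k).
Hypotheses (S1 : state phi q1 u1 ut1 ux1) (S2 : state phi q2 u2 ut2 ux2)
           (Sm : state phi p um utm uxm).

(** The scalars -1, -1/2 and 1 are kept visible, in the literal form that [inH1L2_comb] produces. *)
Let dif t x := u1 t x + (-1) * u2 t x.
Let dift t x := ut1 t x + (-1) * ut2 t x.
Let dev t x := um t x + (- 2^-1) * (u1 t x + 1 * u2 t x).
Let devt t x := utm t x + (- 2^-1) * (ut1 t x + 1 * ut2 t x).

Let Hdif : inH1L2 l T dif dift.
Proof. exact: inH1L2_comb (state_H1L2 S1) (state_H1L2 S2). Qed.

Let Hdev : inH1L2 l T dev devt.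
Proof.
apply: inH1L2_comb (state_H1L2 Sm) _.
exact: inH1L2_comb (state_H1L2 S1) (state_H1L2 S2).
Qed.

Let z0 : `[0, T] 0. Proof. by rewrite /= in_itv/= lexx ltW. Qed.

Lemma state_difference_bound t : `[0, T] t ->
  ipx (u1 t \- u2 t) (u1 t \- u2 t) <= 4 * k ^+ 2 * T ^+ 2 * (M ^+ 2 * l).
Proof.
move=> tT.
have -> : ipx (u1 t \- u2 t) (u1 t \- u2 t) = ipx (dif t) (dif t).
  by apply: eq_ip => x _; rewrite /dif /=; ring.
have M0 : 0 <= M ^+ 2 * l by apply: mulr_ge0 (sqr_ge0 M) (ltW l0).
(* The form 2 T K of [energy_gronwall], where K is the Young weight 2T times k^2 times the bound M^2
   l on |u2|^2. *)
have -> : 4 * k ^+ 2 * T ^+ 2 * (M ^+ 2 * l) =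
  2 * T * (2 * T * k ^+ 2 * (M ^+ 2 * l)) by ring.
apply: (energy_gronwall T0 Hdif) => //.
- by apply: mulr_ge0 => //; apply: mulr_ge0 (sqr_ge0 k); exact: mulr_ge0 (ltW T0).
- apply: (ip_ae_eq0 (H1L2_sqx Hdif z0)).
  apply: ae_mono (ae_and (state_init S1) (state_init S2)) => x [h1 h2] Ix.
  by rewrite /dif h1// h2//; ring.
have T2 : 0 < 2 * T by rewrite mulr_gt0.
apply: ae_mono (ae_and (ae_and (state_good S1) (state_eq S1))
  (ae_and (state_good S2) (state_eq S2))) => r [[g1 e1] [g2 e2]] Jr.
have [ju1 jt1 js1 h1] := g1 Jr; have [ju2 jt2 js2 h2] := g2 Jr.
have L1 := (inL2_sqint _ _).2 ju1; have L2 := (inL2_sqint _ _).2 ju2.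
have jF1 := coef_sqx bq1 ju1; have jF2 := coef_sqx bq2 ju2.
have E (g s' : R -> R) := @weq_combl (-1) _ _ _ _ _ _ g s' jt1 js1 jF1 jt2 js2 jF2.
have E1 := E _ _ ju1 js1 (e1 Jr _ _ L1 h1) (e2 Jr _ _ L1 h1).
have E2 := E _ _ ju2 js2 (e1 Jr _ _ L2 h2) (e2 Jr _ _ L2 h2).
have jt := sqintD mI jt1 (sqintZ mI (-1) jt2).
have js := sqintD mI js1 (sqintZ mI (-1) js2).
have jF := sqintD mI jF1 (sqintZ mI (-1) jF2).
have ju := sqintD mI ju1 (sqintZ mI (-1) ju2).
have Ed := weq_combr (-1) jt js jF ju1 js1 ju2 js2 E1 E2.
apply: (weq_le Ed).
have rT : `[0, T] r by exact: subset_itv_oo_cc Jr.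
have SB : forall x, I x -> - ((q1 \* u1 r \+ -1 \*o (q2 \* u2 r)) x *
    (u1 r \+ -1 \*o u2 r) x) <=
    k * `|u2 r x| * `|(u1 r \+ -1 \*o u2 r) x|.
  move=> x Ix /=; have /andP[q10 _] := bq1.2 x Ix.
  set d := u1 r x + _; apply: (@le_trans _ _ (- ((q1 x - q2 x) * u2 r x * d))).
    (* The splitting q1 u1 - q2 u2 = q1 d + (q1 - q2) u2; its first part has a sign. *)
    rewrite (_ : _ * d = q1 x * d ^+ 2 + (q1 x - q2 x) * u2 r x * d).
      by rewrite lerN2 lerDr mulr_ge0// sqr_ge0.
    by rewrite /d; ring.
  apply: (le_trans (ler_norm _)); rewrite normrN !normrM.
  by rewrite ler_wpM2r// ler_wpM2r// qk.
apply: (le_trans (ip_source_bound T2 jF ju ju2 SB)).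
rewrite lerD2r ler_wpM2l//; first exact: mulr_ge0 (ltW T2) (sqr_ge0 _).
exact: state_bound bq2 S2 rT.
Qed.

Lemma state_deviation_bound t : `[0, T] t ->
  ipx (fun x => um t x - (u1 t x + u2 t x) / 2)
      (fun x => um t x - (u1 t x + u2 t x) / 2) <=
  k ^+ 4 * T ^+ 4 * (M ^+ 2 * l).
Proof.
move=> tT.
have -> : ipx (fun x => um t x - (u1 t x + u2 t x) / 2)
      (fun x => um t x - (u1 t x + u2 t x) / 2) = ipx (dev t) (dev t).
  by apply: eq_ip => x _; rewrite /dev; field.
pose D := 4 * k ^+ 2 * T ^+ 2 * (M ^+ 2 * l).
have -> : k ^+ 4 * T ^+ 4 * (M ^+ 2 * l) =
  2 * T * (2 * T * (k / 4) ^+ 2 * D) by rewrite /D; field.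
have M0 : 0 <= M ^+ 2 * l by apply: mulr_ge0 (sqr_ge0 M) (ltW l0).
apply: (energy_gronwall T0 Hdev) => //.
- apply: mulr_ge0; first by apply: mulr_ge0 (sqr_ge0 _); exact: mulr_ge0 (ltW T0).
  by apply: mulr_ge0 => //; apply: mulr_ge0 (sqr_ge0 T); exact: mulr_ge0 (sqr_ge0 k).
- apply: (ip_ae_eq0 (H1L2_sqx Hdev z0)).
  apply: ae_mono (ae_and (state_init Sm) (ae_and (state_init S1) (state_init S2))).
  by move=> x [hm [h1 h2]] Ix; rewrite /dev hm// h1// h2//; field.
have T2 : 0 < 2 * T by rewrite mulr_gt0.
apply: ae_mono (ae_and (ae_and (state_good Sm) (state_eq Sm))
  (ae_and (ae_and (state_good S1) (state_eq S1))
          (ae_and (state_good S2) (state_eq S2)))).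
move=> r [[gm em] [[g1 e1] [g2 e2]]] Jr.
have [jum jtm jsm hm] := gm Jr.
have [ju1 jt1 js1 h1] := g1 Jr; have [ju2 jt2 js2 h2] := g2 Jr.
have jF1 := coef_sqx bq1 ju1; have jF2 := coef_sqx bq2 ju2.
have jFm := coef_sqx bp jum.
have jt12 := sqintD mI jt1 (sqintZ mI 1 jt2).
have js12 := sqintD mI js1 (sqintZ mI 1 js2).
have jF12 := sqintD mI jF1 (sqintZ mI 1 jF2).
have ju12 := sqintD mI ju1 (sqintZ mI 1 ju2).
(* The equation of um - (u1 + u2)/2 against an arbitrary test g; below, g runs through the three
   states. *)
have E g dg (jg : sqx g) (js' : sqx (fun x => Num.sqrt (a x) * dg x))
    (hg : inH1a a l g dg) :=
  let Lg := (inL2_sqint _ _).2 jg in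
  weq_combl (- 2^-1) jtm jsm jFm jt12 js12 jF12 jg js' (em Jr _ _ Lg hg)
    (weq_combl 1 jt1 js1 jF1 jt2 js2 jF2 jg js' (e1 Jr _ _ Lg hg) (e2 Jr _ _ Lg hg)).
have jt := sqintD mI jtm (sqintZ mI (- 2^-1) jt12).
have js := sqintD mI jsm (sqintZ mI (- 2^-1) js12).
have jF := sqintD mI jFm (sqintZ mI (- 2^-1) jF12).
have ju := sqintD mI jum (sqintZ mI (- 2^-1) ju12).
have Ed := weq_combr (- 2^-1) jt js jF jum jsm ju12 js12 (E _ _ jum jsm hm)
  (weq_combr 1 jt js jF ju1 js1 ju2 js2 (E _ _ ju1 js1 h1) (E _ _ ju2 js2 h2)).
apply: (weq_le Ed).
have rT : `[0, T] r by exact: subset_itv_oo_cc Jr.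
have jd := sqintB mI ju1 ju2.
set F := p \* um r \+ _ in jF *; set w := um r \+ _ in ju *.
have SB : forall x, I x -> - (F x * w x) <= (k / 4) * `|(u1 r \- u2 r) x| * `|w x|.
  move=> x Ix /=; have /andP[p0 _] := bp.2 x Ix.
  apply: (@le_trans _ _ ((q1 x - q2 x) / 4 * (u1 r x - u2 r x) * w x)).
    (* The mean of the products q_i u_i exceeds the product of their means by (q1 - q2)(u1 - u2)/4.
       This product of two small differences is the origin of the second power of k T. *)
    rewrite (_ : F x * w x = p x * w x ^+ 2 - (q1 x - q2 x) / 4 * (u1 r x - u2 r x) * w x).
      by rewrite opprB lerBlDr lerDl mulr_ge0// sqr_ge0.
    by rewrite /F /w /= pE//; field.
  apply: (le_trans (ler_norm _)); rewrite !normrM.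
  rewrite ler_wpM2r// ler_wpM2r// (ger0_norm (_ : 0 <= 4^-1))//.
  by rewrite ler_wpM2r// qk.
apply: (le_trans (ip_source_bound T2 jF ju jd SB)).
rewrite lerD2r ler_wpM2l//; first exact: mulr_ge0 (ltW T2) (sqr_ge0 _).
exact: state_difference_bound.
Qed.

End states.

(** * Weak gradients and admissible coefficients *)

Section cauchy_schwarz.
Context d {X : measurableType d} {R : realType}.
Variables (m : {measure set X -> \bar R}) (D : set X).
Hypothesis mD : measurable D.

(** Young's inequality with the optimal weight G/|A|. For A nonzero, G = 0 is first excluded by the
    weight |A|/(F + 1), which would give 2 |A| <= |A|. *)
Lemma ip_cauchy_schwarz (f g : X -> R) : sqint m D f -> sqint m D g ->
  ip m D f g ^+ 2 <= ip m D f f * ip m D g g.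
Proof.
move=> jf jg; set A := ip m D f g; set F := ip m D f f; set G := ip m D g g.
have F0 : 0 <= F := ip_ge0 m D f; have G0 : 0 <= G := ip_ge0 m D g.
have [->|A0] := eqVneq A 0; first by rewrite expr0n mulr_ge0.
have A1 : 0 < `|A| by rewrite normr_gt0.
have G1 : 0 < G.
  rewrite lt_neqAle G0 andbT; apply/eqP => G2.
  have e0 : 0 < `|A| / (F + 1) by rewrite divr_gt0// ltr_wpDl.
  have := ip_young_norm mD e0 jf jg; rewrite -/A -/F -/G -G2 mulr0 addr0.
  have : `|A| / (F + 1) * F <= `|A|.
    by rewrite mulrAC ler_pdivrMr ?ltr_wpDl// ler_wpM2l// lerDl.
  by lra.
have e0 : 0 < G / `|A| by rewrite divr_gt0.
have := ip_young_norm mD e0 jf jg; rewrite -/A -/F -/G => H.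
have := ler_wpM2l (ltW A1) H.
rewrite mulrDr invf_div (_ : `|A| * (G / `|A| * F) = F * G); last first.
  by field; rewrite gt_eqF.
rewrite (_ : `|A| * (`|A| / G * G) = `|A| ^+ 2); last by field; rewrite gt_eqF.
rewrite (_ : `|A| * (2 * `|A|) = 2 * `|A| ^+ 2); last by ring.
by rewrite real_normK ?num_real//; lra.
Qed.

Lemma ip_add_le (f g : X -> R) : sqint m D f -> sqint m D g ->
  ip m D (f \+ g) (f \+ g) <= 2 * ip m D f f + 2 * ip m D g g.
Proof.
move=> jf jg; have js := sqintD mD jf jg.
rewrite (ipDl mD jf jg js) (ipDr mD jf jg jf) (ipDr mD jf jg jg) (ipC m D g f).
by have := ip_young mD ltr01 jf jg; rewrite invr1 !mul1r; lra.
Qed.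

Lemma ip_sub_le (f g : X -> R) : sqint m D f -> sqint m D g ->
  ip m D (f \- g) (f \- g) <= 2 * ip m D f f + 2 * ip m D g g.
Proof.
move=> jf jg; have jg' := sqintZ mD (-1) jg.
have := ip_add_le jf jg'.
rewrite (ipZl mD _ jg jg') (ipZr mD _ jg jg) mulN1r mulN1r opprK.
rewrite (@eq_ip _ _ _ m D (f \+ -1 \*o g) (f \- g) (f \+ -1 \*o g) (f \- g))//.
- by move=> x _ /=; rewrite mulN1r.
- by move=> x _ /=; rewrite mulN1r.
Qed.

Lemma ip_sub_sqr (f g : X -> R) : sqint m D f -> sqint m D g ->
  ip m D (f \- g) (f \- g) = ip m D f f - 2 * ip m D f g + ip m D g g.
Proof.
move=> jf jg; have js := sqintB mD jf jg.
rewrite (ipBl mD jf jg js) (ipBr mD jf jg jf) (ipBr mD jf jg jg) (ipC m D g f).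
ring.
Qed.

End cauchy_schwarz.

Section weak_gradients.
Context {R : realType}.
Local Notation mu := (@lebesgue_measure R).
Variables (l : R).
Hypothesis l0 : 0 < l.
Local Notation I := (`]0, l[%classic : set R).
Local Notation RM := (measurableTypeR R).
Local Notation sqx := (sqint mu I).
Local Notation ipx := (ip mu I).

Let mI : @measurable _ RM I. Proof. exact: measurable_itv. Qed.

Lemma locally_integrable_itv (w : R -> R) s t : 0 < s -> t < l ->
  locally_integrable I w -> mu.-integrable `[s, t] (EFin \o w).
Proof.
move=> s0 tl [mw _ fw].
have sub : `[s, t] `<=` I.
  by move=> x; rewrite /= !in_itv/= => /andP[sx xt];
    rewrite (lt_le_trans s0)//= (le_lt_trans xt).
apply/integrableP; split; last exact: fw sub (@segment_compact _ _ _).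
by apply/measurable_EFinP; exact: measurable_funS mw.
Qed.

Lemma weak_grad_FTC (q w : R -> R) s t : {in `]0, l[, continuous q} ->
  is_weak_grad l q w -> 0 < s -> s < t -> t < l ->
  q t - q s = \int[mu]_(x in `]s, t[) w x.
Proof.
move=> cq [_ lw weak] s0 st tl.
have sub : `[s, t] `<=` I.
  by move=> x; rewrite /= !in_itv/= => /andP[sx xt];
    rewrite (lt_le_trans s0)//= (le_lt_trans xt).
apply: (@weak_derivative_FTC R l s t q w (ltW s0) st (ltW tl)).
- apply: continuous_in_subspaceT => x /set_mem xst.
  exact/cq/mem_set/sub.
- apply: integrableS (locally_integrable_itv s0 tl lw) => //.
  exact: subset_itv_oo_cc.
- by move=> eta eta0 _; exact: weak.
Qed.

(** By [weak_grad_FTC] both gradients have the same integral over every compactly contained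
    interval, so their difference vanishes at each of its Lebesgue points. *)
Lemma weak_grad_unique (q w w' : R -> R) : {in `]0, l[, continuous q} ->
  is_weak_grad l q w -> is_weak_grad l q w' ->
  {ae mu, forall x, I x -> w x = w' x}.
Proof.
move=> cq Hw Hw'; have [_ lw _] := Hw; have [_ lw' _] := Hw'.
(* The intervals [s_n, l - s_n] exhaust ]0, l[; the offset 3 gives s_n <= l/3, so that none is
   empty. *)
pose s (n : nat) : R := l / n.+3%:R.
have s0 n : 0 < s n by rewrite divr_gt0.
have sl n : s n < l - s n.
  have : s n <= l / 3 by rewrite ler_pM2l// lef_pV2 ?posrE// ler_nat.
  by move: l0; lra.
pose h n := (w \- w') \_ `[s n, l - s n].
have ih n : mu.-integrable `[s n, l - s n] (EFin \o (fun x => w x - w' x)).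
  have tl : l - s n < l by rewrite ltrBlDr ltrDl.
  by apply: integrable_sub => //; exact: locally_integrable_itv.
have lebP n : {ae mu, forall x, lebesgue_pt (h n) x}.
  by apply: lebesgue_differentiation; exact: integrable_locally (ih n).
have zero n : {ae mu, forall x, `]s n, l - s n[ x -> w x = w' x}.
  apply: ae_mono (lebP n) => x lx /=; rewrite in_itv/= => /andP[sx xs].
  have ihT : mu.-integrable `[s n, l - s n] (EFin \o h n).
    have mcc : @measurable _ RM `[s n, l - s n] by exact: measurable_itv.
    have := (integrable_mkcond _ mcc).1 (ih n).
    by rewrite restrict_EFin; exact: integrableS.
  have [|_ F'] := @FTC1_lebesgue_pt R (h n) (BLeft (s n)) x (l - s n) xs ihT _ lx.
    by rewrite lte_fin.
  have F0 y : s n < y -> y < l - s n -> \int[mu]_(t in `[s n, y]) h n t = 0.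
    move=> sy ys.
    have yl : y < l by rewrite (lt_trans ys)// ltrBlDr ltrDl.
    have iw v : locally_integrable I v -> mu.-integrable `]s n, y[ (EFin \o v).
      move=> lv; apply: integrableS (locally_integrable_itv (s0 n) yl lv) => //.
      exact: subset_itv_oo_cc.
    have ihy : mu.-integrable `[s n, y] (EFin \o h n).
      apply: integrableS ihT => //.
      by apply: subset_itvl; rewrite bnd_simp ltW.
    have -> : \int[mu]_(t in `[s n, y]) h n t = \int[mu]_(t in `]s n, y[) h n t.
      rewrite -Rintegral_itv_obnd_cbnd; last first.
        by apply: integrableS ihy => //; apply: subset_itvr; rewrite bnd_simp.
      rewrite -Rintegral_itv_bndo_bndc//.
      by apply: integrableS ihy => //; exact: subset_itv_oo_cc.
    have -> : \int[mu]_(t in `]s n, y[) h n t = \int[mu]_(t in `]s n, y[) (w t - w' t).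
      apply: eq_Rintegral => t /set_mem; rewrite /= in_itv/= => /andP[st ty].
      by rewrite /h patchE mem_set//= in_itv/= (ltW st) (ltW (lt_trans ty ys)).
    rewrite RintegralB//; [|exact: iw|exact: iw].
    rewrite -(weak_grad_FTC cq Hw (s0 n) sy yl) -(weak_grad_FTC cq Hw' (s0 n) sy yl).
    by rewrite subrr.
  have : h n x = 0.
    rewrite -F' derive1E (@near_eq_derive _ _ _ _ (cst 0))//.
      by rewrite derive_cst.
    near=> y; apply: F0; near: y.
      exact: lt_nbhsr.
    exact: lt_nbhsl.
  rewrite /h patchE mem_set/= ?in_itv/= ?(ltW sx) ?(ltW xs)// => /eqP.
  by rewrite subr_eq0 => /eqP.
have := ae_foralln zero.
apply: ae_mono => x H; rewrite /= in_itv/= => /andP[x0 xl].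
pose e := Num.min x (l - x).
have e0 : 0 < e by rewrite lt_min x0 subr_gt0.
pose n := Num.truncn (l / e).
have sn : s n < e.
  rewrite /s ltr_pdivrMr// mulrC -ltr_pdivrMr//.
  apply: (lt_le_trans (truncnS_gt _)).
  by rewrite ler_nat; exact: leqW (leqW (leqnn _)).
move: sn; rewrite lt_min => /andP[sx sl'].
by apply: (H n); rewrite /= in_itv/= sx ltrBrDr addrC -ltrBrDr.
Unshelve. all: by end_near. Qed.

(** Cauchy-Schwarz against the constant 1 on the interval between x0 and x, whose length is at most
    l. *)
Lemma oscillation_le (q1 q2 w1 w2 : R -> R) x0 x :
  {in `]0, l[, continuous q1} -> {in `]0, l[, continuous q2} ->
  is_weak_grad l q1 w1 -> is_weak_grad l q2 w2 -> sqx w1 -> sqx w2 ->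
  q1 x0 = q2 x0 -> I x0 -> I x ->
  (q1 x - q2 x) ^+ 2 <= l * ipx (w1 \- w2) (w1 \- w2).
Proof.
move=> c1 c2 h1 h2 j1 j2 qx0 Ix0 Ix.
have jw := sqintB mI j1 j2.
have main s t : 0 < s -> s < t -> t < l ->
    (q1 t - q1 s - (q2 t - q2 s)) ^+ 2 <= l * ipx (w1 \- w2) (w1 \- w2).
  move=> s0 st tl.
  have mst : @measurable _ RM `]s, t[ by exact: measurable_itv.
  have sub : `]s, t[ `<=` I by apply: subset_itv; rewrite bnd_simp ltW.
  have subq v : sqx v -> sqint mu `]s, t[ v.
    by move=> [mv jv]; split; [exact: measurable_funS mv|exact: integrableS jv].
  have fin : (mu `]s, t[ < +oo)%E.
    by rewrite lebesgue_measure_itv/=; case: ifP => _; rewrite ?ltry.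
  have jc : sqint mu `]s, t[ (cst 1) by exact: (@sqint_cst _ RM).
  have int v : sqx v -> mu.-integrable `]s, t[ (EFin \o v).
    move=> jv; apply: integrable_ext (sqintM mst (subq _ jv) jc) => y /=.
    by rewrite mulr1.
  rewrite (weak_grad_FTC c1 h1 s0 st tl) (weak_grad_FTC c2 h2 s0 st tl).
  rewrite -(RintegralB mst (int _ j1) (int _ j2)).
  have -> : \int[mu]_(y in `]s, t[) (w1 y - w2 y) = ip mu `]s, t[ (w1 \- w2) (cst 1).
    by apply: eq_Rintegral => y _ /=; rewrite mulr1.
  apply: (le_trans (ip_cauchy_schwarz mst (subq _ jw) jc)).
  have -> : ip mu `]s, t[ (cst 1) (cst 1) = t - s.
    rewrite /ip (@eq_Rintegral _ _ _ mu _ (fun=> 1)); last first.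
      by move=> y _ /=; rewrite mulr1.
    by rewrite Rintegral_cst//= lebesgue_measure_itv/= lte_fin st -EFinB/= mul1r.
  rewrite mulrC; apply: ler_pM; [by rewrite subr_ge0 ltW|exact: ip_ge0|lra|].
  rewrite /ip Rintegral_mkcond [leRHS]Rintegral_mkcond.
  apply: le_Rintegral => //.
  - rewrite -restrict_EFin; apply/(integrable_mkcond _ mst).
    have jst := subq _ jw.
    exact: (@sqintM _ _ _ mu _ mst _ _ jst jst).
  - rewrite -restrict_EFin; apply/(integrable_mkcond _ mI).
    exact: (@sqintM _ _ _ mu _ mI _ _ jw jw).
  - move=> y _; rewrite !patchE; case: ifPn => [/set_mem/sub/mem_set ->//|_].
    by case: ifP => // _; rewrite -expr2 sqr_ge0.
move: Ix0 Ix; rewrite /= !in_itv/= => /andP[a0 b0] /andP[a b].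
have [xx|xx|<-] := ltgtP x0 x.
- rewrite (_ : q1 x - q2 x = q1 x - q1 x0 - (q2 x - q2 x0)); first exact: main.
  by rewrite qx0; ring.
- rewrite -sqrrN (_ : - (q1 x - q2 x) = q1 x0 - q1 x - (q2 x0 - q2 x)).
    exact: main.
  by rewrite qx0; ring.
- by rewrite qx0 subrr expr0n mulr_ge0 ?ip_ge0// ltW.
Qed.

Lemma C0infty_sqx (psi : R -> R) : C0infty l psi -> sqx psi /\ sqx (derive1 psi).
Proof.
move=> [spsi _ _].
have cpsi : continuous psi by exact: (smooth_continuous (n := 0) spsi).
have cdpsi : continuous (derive1 psi).
  by have := smooth_continuous (n := 1) spsi; rewrite derive1n1.
have jf f : continuous f -> sqx f.
  move=> cf; have [c fc] := continuous_itv_bounded 0 l cf.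
  have mf : measurable_fun I f.
    by apply: measurable_funTS; exact: continuous_measurable_fun.
  apply: (@sqint_le _ _ _ mu I mI f (cst c) mf).
    by apply: (@sqint_cst _ RM) => //; exact: itv0_finite.
  move=> x /subset_itv_oo_cc/fc fx.
  by rewrite -(real_normK (num_real (f x))) ler_sqr ?nnegrE// (le_trans _ fx).
by split; exact: jf.
Qed.

Lemma sqx_locally_integrable (f : R -> R) : sqx f -> locally_integrable I f.
Proof.
move=> jf; apply: open_integrable_locally; first exact: interval_open.
have jc : sqx (cst 1) by apply: (@sqint_cst _ RM) => //; exact: itv0_finite.
by apply: integrable_ext (sqintM mI jf jc) => x /=; rewrite mulr1.
Qed.

Lemma is_weak_grad_mean (q1 q2 w1 w2 : R -> R) :
  sqx q1 -> sqx q2 -> sqx w1 -> sqx w2 ->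
  is_weak_grad l q1 w1 -> is_weak_grad l q2 w2 ->
  is_weak_grad l (2^-1 \*o (q1 \+ q2)) (2^-1 \*o (w1 \+ w2)).
Proof.
move=> jq1 jq2 jw1 jw2 [_ _ h1] [_ _ h2].
have jq := sqintD mI jq1 jq2; have jw := sqintD mI jw1 jw2.
split.
- exact: sqx_locally_integrable (sqintZ mI _ jq).
- exact: sqx_locally_integrable (sqintZ mI _ jw).
move=> psi psi0; have [jp jdp] := C0infty_sqx psi0.
rewrite -/(ipx (2^-1 \*o (q1 \+ q2)) (derive1 psi)) -/(ipx (2^-1 \*o (w1 \+ w2)) psi).
rewrite (ipZl mI _ jq jdp) (ipZl mI _ jw jp).
rewrite (ipDl mI jq1 jq2 jdp) (ipDl mI jw1 jw2 jp).
by rewrite [ipx q1 _]h1// [ipx q2 _]h2// -opprD mulrN.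
Qed.

(** The cost is written with the gradient selected by [xget]. Existence makes the selection a
    genuine weak gradient rather than the default 0, and uniqueness replaces it by the
    square-integrable one at hand. *)
Lemma weak_grad_ip (q w : R -> R) : {in `]0, l[, continuous q} ->
  is_weak_grad l q w -> sqx w ->
  \int[mu]_(x in I) (`|weak_grad l q x| ^+ 2) = ipx w w.
Proof.
move=> cq Hw jw.
have Hg : is_weak_grad l q (weak_grad l q).
  rewrite /weak_grad; apply: (@xgetPex _ (fun=> 0) [set w | is_weak_grad l q w]).
  by exists w.
have [_ [mg _ _] _] := Hg.
rewrite -(@ae_eq_ip _ _ _ mu I mI (weak_grad l q) w (weak_grad l q) w mg jw.1 mg jw.1).
- by apply: eq_Rintegral => x _; rewrite real_normK ?num_real// expr2.
- exact: weak_grad_unique cq Hg Hw.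
- exact: weak_grad_unique cq Hg Hw.
Qed.

Lemma Linfty_sqx (g : R -> R) (M : R) : inLinfty l g -> (Linfty_norm l g <= M%:E)%E ->
  sqx g /\ ipx g g <= M ^+ 2 * l.
Proof.
move=> Lg gM.
have mg : measurable_fun I g.
  have H := (@measurable_restrictT _ _ RM RM I g mI).2; apply: H.
  by move: Lg; rewrite /inLinfty inE => /andP[+ _]; rewrite inE.
have ae_g : {ae mu, forall x, I x -> `|g x| <= M}.
  (* The norm of exponent +oo is an essential supremum once the whole space has positive measure,
     which follows from that of ]0, l[. *)
  move: gM; rewrite /Linfty_norm unlock ifT; last first.
    apply: (@lt_le_trans _ _ (mu I)); last by apply: le_measure; rewrite ?inE.
    by rewrite lebesgue_measure_itv/= lte_fin l0 sube0 lte_fin.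
  move=> /ess_supP; apply: ae_mono => x + Ix.
  by rewrite /= patchE mem_set.
have jg : sqx g.
  split=> //; have mg2 := measurable_funX 2 mg.
  apply/integrableP; split; first exact/measurable_EFinP.
  apply: (@le_lt_trans _ _ (\int[mu]_(x in I) (M ^+ 2)%:E)%E).
    apply: ae_ge0_le_integral => //.
    - by apply/measurable_EFinP; exact: measurableT_comp.
    - by move=> x _; rewrite lee_fin sqr_ge0.
    - apply: ae_mono ae_g => x H Ix /=; have {}H := H Ix.
      rewrite lee_fin ger0_norm ?sqr_ge0// -(real_normK (num_real (g x))).
      by rewrite ler_sqr ?nnegrE// (le_trans _ H).
  by rewrite integral_cst// lte_mul_pinfty ?lee_fin ?sqr_ge0//; exact: itv0_finite.
by split => //; exact: ip_ae_bound.
Qed.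

End weak_gradients.

(** * Comparison of the costs at the midpoint, and conclusion *)

Section midpoint.
Context d {X : measurableType d} {R : realType}.
Variables (m : {measure set X -> \bar R}) (D : set X).
Hypothesis mD : measurable D.
Local Notation sq := (sqint m D).
Local Notation ip2 := (ip m D).

(** With d = u1 - u2, the sum u1 g1 + u2 g2 is h (g1 + g2) + d (g1 - g2)/2, and |u1|^2 + |u2|^2 = 2
    |h|^2 + |d|^2 / 2. The resulting -|d|^2 on the right has the favourable sign and is dropped. *)
Lemma midpoint_cost (N : R) (u1 u2 um g1 g2 w1 w2 : X -> R) :
  sq u1 -> sq u2 -> sq um -> sq g1 -> sq g2 -> sq w1 -> sq w2 ->
  let h := 2^-1 \*o (u1 \+ u2) in
  let w := 2^-1 \*o (w1 \+ w2) in
  2^-1 * ip2 (u1 \- g1) (u1 \- g1) + N / 2 * ip2 w1 w1 <=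
  2^-1 * ip2 (um \- g1) (um \- g1) + N / 2 * ip2 w w ->
  2^-1 * ip2 (u2 \- g2) (u2 \- g2) + N / 2 * ip2 w2 w2 <=
  2^-1 * ip2 (um \- g2) (um \- g2) + N / 2 * ip2 w w ->
  N * ip2 (w1 \- w2) (w1 \- w2) <=
  4 * ip2 (um \- h) ((um \+ h) \- (g1 \+ g2)) + 2 * ip2 (u1 \- u2) (g1 \- g2).
Proof.
move=> j1 j2 jm jg1 jg2 jw1 jw2 h w.
have j12 := sqintD mD j1 j2; have jh := sqintZ mD 2^-1 j12.
have jw12 := sqintD mD jw1 jw2; have jw := sqintZ mD 2^-1 jw12.
have jv := sqintB mD jm jh; have js := sqintD mD jm jh; have jg := sqintD mD jg1 jg2.
have jd := sqintB mD j1 j2.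
rewrite !(ip_sub_sqr mD)// => H1 H2.
have Ew : ip2 w w = 4^-1 * (ip2 w1 w1 + 2 * ip2 w1 w2 + ip2 w2 w2).
  rewrite /w (ipZl mD _ jw12 jw) (ipZr mD _ jw12 jw12) (ipDl mD jw1 jw2 jw12).
  rewrite (ipDr mD jw1 jw2 jw1) (ipDr mD jw1 jw2 jw2) (ipC m D w2 w1).
  by field.
have Ed : ip2 (u1 \- u2) (g1 \- g2) =
    ip2 u1 g1 - ip2 u1 g2 - (ip2 u2 g1 - ip2 u2 g2).
  have jgB := sqintB mD jg1 jg2.
  by rewrite (ipBl mD j1 j2 jgB) (ipBr mD jg1 jg2 j1) (ipBr mD jg1 jg2 j2).
have Eh f : sq f -> ip2 h f = 2^-1 * (ip2 u1 f + ip2 u2 f).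
  by move=> jf; rewrite (ipZl mD _ j12 jf) (ipDl mD j1 j2 jf).
have Ehh : ip2 h h = 4^-1 * (ip2 u1 u1 + 2 * ip2 u1 u2 + ip2 u2 u2).
  rewrite Eh// (ipC m D u1 h) (ipC m D u2 h) !Eh// (ipC m D u2 u1).
  by field.
have Ev : ip2 (um \- h) ((um \+ h) \- (g1 \+ g2)) =
    ip2 um um - ip2 h h - (ip2 um g1 + ip2 um g2 - (ip2 h g1 + ip2 h g2)).
  have jsg := sqintB mD js jg.
  rewrite (ipBl mD jm jh jsg) (ipBr mD js jg jm) (ipBr mD js jg jh).
  rewrite (ipDr mD jm jh jm) (ipDr mD jm jh jh) (ipDr mD jg1 jg2 jm) (ipDr mD jg1 jg2 jh).
  rewrite (ipC m D h um); ring.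
have D0 := ip_ge0 m D (u1 \- u2); rewrite (ip_sub_sqr mD j1 j2) in D0.
rewrite Ev Ehh Ed !Eh//; move: H1 H2 D0; rewrite Ew.
set a1 := ip2 u1 u1; set a2 := ip2 u2 u2; set a3 := ip2 um um; set a4 := ip2 u1 u2.
set b1 := ip2 u1 g1; set b2 := ip2 u1 g2; set b3 := ip2 u2 g1; set b4 := ip2 u2 g2.
set b5 := ip2 um g1; set b6 := ip2 um g2; set c1 := ip2 g1 g1; set c2 := ip2 g2 g2.
set e1 := ip2 w1 w1; set e2 := ip2 w2 w2; set e3 := ip2 w1 w2.
clearbody a1 a2 a3 a4 b1 b2 b3 b4 b5 b6 c1 c2 e1 e2 e3 => {Ev Ehh Ed Ew Eh}.
by move=> H1 H2 D0; clear -H1 H2 D0; lra.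
Qed.

End midpoint.

Section admissible_coefficients.
Context {R : realType}.
Local Notation mu := (@lebesgue_measure R).
Variables (alpha beta l : R).
Hypotheses (alpha0 : 0 < alpha) (l0 : 0 < l).
Local Notation I := (`]0, l[%classic : set R).
Local Notation RM := (measurableTypeR R).

Let mI : @measurable _ RM I. Proof. exact: measurable_itv. Qed.

Lemma admissible_bounded_coef (q : R -> R) :
  admissible alpha beta l q -> bounded_coef l q beta.
Proof.
move=> [qab cq _]; split.
  by apply: open_continuous_measurable_fun; first exact: interval_open.
by move=> x /qab/andP[aq qb]; rewrite qb (le_trans (ltW alpha0)).
Qed.

Lemma admissible_mean (q1 q2 w1 w2 : R -> R) :
  admissible alpha beta l q1 -> admissible alpha beta l q2 ->
  is_weak_grad l q1 w1 -> is_weak_grad l q2 w2 -> inL2 l w1 -> inL2 l w2 ->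
  admissible alpha beta l (2^-1 \*o (q1 \+ q2)).
Proof.
move=> [b1 c1 [/inL2_sqint j1 _]] [b2 c2 [/inL2_sqint j2 _]] h1 h2.
move=> /inL2_sqint jw1 /inL2_sqint jw2; split.
- move=> x Ix; have /andP[? ?] := b1 x Ix; have /andP[? ?] := b2 x Ix.
  by rewrite /=; lra.
- move=> x Ix; apply: cvgM; first exact: cvg_cst.
  by apply: cvgD; [exact: c1|exact: c2].
- split; first exact/inL2_sqint/(sqintZ mI _ (sqintD mI j1 j2)).
  exists (2^-1 \*o (w1 \+ w2)); first exact: is_weak_grad_mean.
  exact/inL2_sqint/(sqintZ mI _ (sqintD mI jw1 jw2)).
Qed.

Lemma cost_ip (T N : R) (usol : (R -> R) -> R -> R -> R) (g q w : R -> R) :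
  {in `]0, l[, continuous q} -> is_weak_grad l q w -> sqint mu I w ->
  cost l T N usol g q =
  2^-1 * ip mu I (usol q T \- g) (usol q T \- g) + N / 2 * ip mu I w w.
Proof.
move=> cq hw jw; rewrite /cost (weak_grad_ip l0 cq hw jw); congr (_ * _ + _).
by apply: eq_Rintegral => x _; rewrite real_normK ?num_real// expr2.
Qed.

End admissible_coefficients.

(* The choice of T0 makes the term that is quadratic in k absorbable. *)
Lemma absorb_small_time (R : realType) (l N T M rho k G Gam : R) :
  0 < l -> 0 < N -> 0 < rho -> rho ^+ 3 = l / N -> k ^+ 2 = l * G ->
  T ^+ 2 * (M ^+ 2 * l * (34 + 8 * rho)) <= N / (2 * l) ->
  N * G <= k ^+ 2 * T ^+ 2 * (M ^+ 2 * l) * (34 + 8 * rho) + Gam / (2 * rho) ->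
  k ^+ 2 <= rho ^+ 2 * Gam.
Proof.
move=> l0 N0 r0 r3 kG small H.
have k20 : 0 <= k ^+ 2 := sqr_ge0 k.
have GE : G = k ^+ 2 / l by rewrite kG mulrAC divff ?mul1r// gt_eqF.
have A : k ^+ 2 * T ^+ 2 * (M ^+ 2 * l) * (34 + 8 * rho) <= k ^+ 2 * (N / (2 * l)).
  rewrite (_ : k ^+ 2 * T ^+ 2 * (M ^+ 2 * l) * (34 + 8 * rho) =
    k ^+ 2 * (T ^+ 2 * (M ^+ 2 * l * (34 + 8 * rho)))); last by ring.
  exact: ler_wpM2l.
have B : N * G <= k ^+ 2 * (N / (2 * l)) + Gam / (2 * rho).
  by apply: (le_trans H); rewrite lerD2r.
have C : k ^+ 2 * N / (2 * l) <= Gam / (2 * rho).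
  move: B; rewrite GE (_ : N * (k ^+ 2 / l) =
    k ^+ 2 * (N / (2 * l)) + k ^+ 2 * N / (2 * l)); last by field; rewrite gt_eqF.
  by rewrite lerD2l.
have E : 0 < 2 * l / N by rewrite divr_gt0// mulr_gt0.
have := ler_wpM2l (ltW E) C.
rewrite (_ : 2 * l / N * (k ^+ 2 * N / (2 * l)) = k ^+ 2); last first.
  by field; rewrite !gt_eqF.
rewrite (_ : 2 * l / N * (Gam / (2 * rho)) = l / N * Gam / rho); last first.
  by field; rewrite !gt_eqF.
by rewrite -r3 (_ : rho ^+ 3 * Gam / rho = rho ^+ 2 * Gam)//; field; rewrite gt_eqF.
Qed.

Lemma cube_root_quotient (R : realType) (l N : R) : 0 < l -> 0 < N ->
  (l `^ (3^-1) / N `^ (3^-1)) ^+ 3 = l / N.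
Proof.
move=> l0 N0; have root3 (x : R) : 0 < x -> (x `^ (3^-1)) ^+ 3 = x.
  by move=> x0; rewrite -powR_mulrn ?powR_ge0// -powRrM mulVf// powRr1// ltW.
by rewrite expr_div_n !root3.
Qed.

Unset Implicit Arguments.
Set Strict Implicit.
Set Printing Implicit Defensive.

Theorem theorem5p7 (R : realType) (alpha beta M : R)
  (alpha_gt0 : 0 < alpha) (beta_gt0 : 0 < beta) :
  exists2 C : R, 0 < C &
  forall l N : R, 0 < l -> 0 < N ->
  exists2 T0 : R, 0 < T0 &
  forall a phi g1 g2 : R -> R,
  C1_closed l a -> a 0 = 0 -> a l = 0 ->
  (forall x, `]0, l[ x -> 0 < a x) ->
  smooth_on `]0, l[ phi ->
  (forall x, `]0, l[ x -> 0 <= phi x <= M) ->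
  (exists2 x, `]0, l[ x & phi x != 0) ->
  inLinfty l g1 -> (Linfty_norm l g1 <= M%:E)%E ->
  inLinfty l g2 -> (Linfty_norm l g2 <= M%:E)%E ->
  forall T : R, 0 < T -> T <= T0 ->
  forall usol : (R -> R) -> R -> R -> R,
  (forall q, admissible alpha beta l q -> weak_solution a phi l T q (usol q)) ->
  forall q1 q2 : R -> R,
  is_minimizer alpha beta l T N usol g1 q1 ->
  is_minimizer alpha beta l T N usol g2 q2 ->
  (exists2 x0, `]0, l[ x0 & q1 x0 = q2 x0) ->
  forall x, `]0, l[ x ->
  `|q1 x - q2 x| <=
    C * l `^ (3^-1) / N `^ (3^-1) * L2norm l (fun y => g1 y - g2 y).
Proof.
exists 1 => // l N l0 N0.
pose rho : R := l `^ (3^-1) / N `^ (3^-1).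
have rho0 : 0 < rho by rewrite divr_gt0// powR_gt0.
have rho3 : rho ^+ 3 = l / N := cube_root_quotient l0 N0.
(* Here 34 = 2 (1 + 16) and 8 rho = 4 (2 rho) are the totals of the two Young inequalities at the
   end. *)
pose A := M ^+ 2 * l * (34 + 8 * rho).
have A0 : 0 <= A.
  apply: mulr_ge0; first exact: mulr_ge0 (sqr_ge0 M) (ltW l0).
  by move: rho0; lra.
have B0 : 0 < N / (2 * l) / (A + 1).
  by rewrite !divr_gt0 ?mulr_gt0// ltr_wpDl.
(* This gives T^2 A <= N/(2l), so that half of N G = k^2 N/l absorbs the terms in k^2. Adding 1 to A
   avoids a division by 0 when M = 0. *)
exists (Num.sqrt (N / (2 * l) / (A + 1))); first by rewrite sqrtr_gt0.
move=> a phi g1 g2 [ca _] _ _ a_gt0 _ phiM _ Lg1 g1M Lg2 g2M T T_gt0 TT0.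
move=> usol Hu q1 q2 [adm1 min1] [adm2 min2] [x0 Ix0 qx0] x Ix.
set mu := @lebesgue_measure R.
set I : set R := `]0, l[%classic.
have mI : @measurable _ (measurableTypeR R) I by exact: measurable_itv.
have small : T ^+ 2 * (M ^+ 2 * l * (34 + 8 * rho)) <= N / (2 * l).
  have T2 : T ^+ 2 <= N / (2 * l) / (A + 1).
    rewrite -[leRHS]sqr_sqrtr ?(ltW B0)//.
    by rewrite ler_sqr ?nnegrE ?sqrtr_ge0// ltW.
  have A1 : 0 < A + 1 by rewrite ltr_wpDl.
  apply: (le_trans (ler_wpM2r A0 T2)); rewrite mulrAC ler_pdivrMr//.
  by rewrite ler_wpM2l ?lerDl// divr_ge0 ?mulr_ge0// ltW.
have ma : measurable_fun I a.
  have : measurable_fun `[0, l] a by apply: subspace_continuous_measurable_fun.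
  by apply: measurable_funS => //; exact: subset_itv_oo_cc.
have [_ c1 [_ [w1 hw1 /inL2_sqint jw1]]] := adm1.
have [_ c2 [_ [w2 hw2 /inL2_sqint jw2]]] := adm2.
pose p := 2^-1 \*o (q1 \+ q2).
have admp : admissible alpha beta l p.
  by apply: (admissible_mean adm1 adm2 hw1 hw2); exact/inL2_sqint.
have [_ cp [/inL2_sqint jp _]] := admp.
have [_ _ [/inL2_sqint jq1 _]] := adm1; have [_ _ [/inL2_sqint jq2 _]] := adm2.
have hw := is_weak_grad_mean jq1 jq2 jw1 jw2 hw1 hw2.
have jw := sqintZ mI 2^-1 (sqintD mI jw1 jw2).
have bq1 := admissible_bounded_coef alpha_gt0 adm1.
have bq2 := admissible_bounded_coef alpha_gt0 adm2.
have bp := admissible_bounded_coef alpha_gt0 admp.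
have [ut1 [ux1 S1]] := weak_solution_state ma a_gt0 (Hu _ adm1).
have [ut2 [ux2 S2]] := weak_solution_state ma a_gt0 (Hu _ adm2).
have [utm [uxm Sm]] := weak_solution_state ma a_gt0 (Hu _ admp).
have TT : `[0, T] T by rewrite /= in_itv/= lexx ltW.
have ju1 := H1L2_sqx (state_H1L2 S1) TT.
have ju2 := H1L2_sqx (state_H1L2 S2) TT.
have jum := H1L2_sqx (state_H1L2 Sm) TT.
have [jg1 G1] := Linfty_sqx l0 Lg1 g1M.
have [jg2 G2] := Linfty_sqx l0 Lg2 g2M.
pose G := ip mu I (w1 \- w2) (w1 \- w2).
have G0 : 0 <= G := ip_ge0 _ _ _.
(* Taken from the gradients instead of as the maximum of |q1 - q2|, which it dominates: in this way
   the bound on N G closes directly on k^2. *)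
pose k := Num.sqrt (l * G).
have k0 : 0 <= k := sqrtr_ge0 _.
have kE : k ^+ 2 = l * G by rewrite sqr_sqrtr// mulr_ge0// ltW.
have qk y : I y -> `|q1 y - q2 y| <= k.
  move=> Iy; rewrite -ler_sqr ?nnegrE// kE real_normK ?num_real//.
  exact: (oscillation_le l0 c1 c2 hw1 hw2 jw1 jw2 qx0 Ix0 Iy).
have jgam := sqintB mI jg1 jg2.
pose Gam := ip mu I (g1 \- g2) (g1 \- g2).
have GamE : L2norm l (fun y => g1 y - g2 y) ^+ 2 = Gam := L2norm_ip jgam.
rewrite mul1r -/rho; apply: (le_trans (qk x Ix)).
have L0 : 0 <= rho * L2norm l (fun y => g1 y - g2 y).
  by apply: mulr_ge0 (ltW rho0) _; exact: L2norm_ge0.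
rewrite -ler_sqr ?nnegrE// exprMn GamE.
(* The case k = 0 is separate, since k^2 T^2 is inverted below to form a weight. *)
have [kz|kn0] := eqVneq k 0.
  by rewrite kz expr0n mulr_ge0 ?sqr_ge0// ip_ge0.
have k_gt0 : 0 < k by rewrite lt_neqAle eq_sym kn0.
apply: (absorb_small_time l0 N0 rho0 rho3 kE small).
have := min1 p admp.
rewrite (cost_ip l0 _ _ _ _ c1 hw1 jw1) (cost_ip l0 _ _ _ _ cp hw jw).
have := min2 p admp.
rewrite (cost_ip l0 _ _ _ _ c2 hw2 jw2) (cost_ip l0 _ _ _ _ cp hw jw).
move=> H2 H1; have := midpoint_cost mI ju1 ju2 jum jg1 jg2 jw1 jw2 H1 H2.
set h := 2^-1 \*o _; set v := usol p T \- h; set b := _ \- (g1 \+ g2).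
set d := usol q1 T \- usol q2 T; rewrite -/G => /le_trans; apply.
have jh : sqint mu I h := sqintZ mI 2^-1 (sqintD mI ju1 ju2).
have jv : sqint mu I v := sqintB mI jum jh.
have jb : sqint mu I b := sqintB mI (sqintD mI jum jh) (sqintD mI jg1 jg2).
have jd : sqint mu I d := sqintB mI ju1 ju2.
have pE y : I y -> p y = (q1 y + q2 y) / 2 by rewrite /p /= mulrC.
have Y1 := state_bound l0 T_gt0 phiM bq1 S1 TT.
have Y2 := state_bound l0 T_gt0 phiM bq2 S2 TT.
have Ym := state_bound l0 T_gt0 phiM bp Sm TT.
have Yd : ip mu I d d <= 4 * k ^+ 2 * T ^+ 2 * (M ^+ 2 * l) :=
  state_difference_bound l0 T_gt0 phiM bq1 bq2 qk S1 S2 TT.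
have Yv : ip mu I v v <= k ^+ 4 * T ^+ 4 * (M ^+ 2 * l).
  have := state_deviation_bound l0 T_gt0 phiM bq1 bq2 bp pE qk S1 S2 Sm TT.
  rewrite (@eq_ip _ _ _ mu I _ v _ v)// => y _; rewrite /v /h /=;
    by rewrite [2^-1 * _]mulrC.
set Z := M ^+ 2 * l in Y1 Y2 Ym Yd Yv G1 G2 *.
have Yh : ip mu I h h <= Z.
  have j12 := sqintD mI ju1 ju2.
  rewrite /h (ipZl mI _ j12 jh) (ipZr mI _ j12 j12).
  have aux (c y z : R) : c <= 2 * y + 2 * z -> y <= Z -> z <= Z ->
      2^-1 * (2^-1 * c) <= Z by lra.
  exact: aux (ip_add_le mI ju1 ju2) Y1 Y2.
(* Each of um, h, g1, g2 has square norm at most Z, and two applications of |f + g|^2 <= 2 |f|^2 + 2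
   |g|^2 give the factor 16. *)
have Yb : ip mu I b b <= 16 * Z.
  have aux (c y z y1 y2 z1 z2 : R) : c <= 2 * y + 2 * z ->
      y <= 2 * y1 + 2 * y2 -> z <= 2 * z1 + 2 * z2 ->
      y1 <= Z -> y2 <= Z -> z1 <= Z -> z2 <= Z -> c <= 16 * Z by lra.
  exact: aux (ip_sub_le mI (sqintD mI jum jh) (sqintD mI jg1 jg2))
    (ip_add_le mI jum jh) (ip_add_le mI jg1 jg2) Ym Yh G1 G2.
(* As |v|^2 <= K^2 Z and |b|^2 <= 16 Z, the weight 1/K makes both Young terms of order K Z, hence
   quadratic in k. *)
pose K := k ^+ 2 * T ^+ 2.
have K0 : 0 < K by rewrite mulr_gt0 ?exprn_gt0.
have KV0 : 0 < K^-1 by rewrite invr_gt0.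
have V := ip_young mI KV0 jv jb; rewrite invrK in V.
have KV : K^-1 * ip mu I v v <= K * Z.
  rewrite ler_pdivrMl// (le_trans Yv)// (_ : K * (K * Z) = k ^+ 4 * T ^+ 4 * Z)//.
  by rewrite /K; ring.
have KB : K * ip mu I b b <= K * (16 * Z) by rewrite ler_wpM2l// ltW.
(* With weight 2 rho the part in |d|^2 is again of order K, and the remainder Gam/(2 rho) is what
   [absorb_small_time] converts into rho^2 Gam. *)
have lam0 : 0 < 2 * rho by rewrite mulr_gt0.
have W := ip_young mI lam0 jd jgam; rewrite -/Gam in W.
have WD : 2 * rho * ip mu I d d <= 2 * rho * (4 * K * Z).
  by rewrite ler_wpM2l ?(ltW lam0)// (le_trans Yd)// /K mulrA.
rewrite -/K (_ : K * Z * (34 + 8 * rho) + Gam / (2 * rho) =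
  2 * (K * Z + K * (16 * Z)) + (2 * rho * (4 * K * Z) + (2 * rho)^-1 * Gam)).
  apply: lerD; last by apply: (le_trans W); rewrite lerD2r.
  rewrite (_ : 4 = 2 * 2); last by ring.
  rewrite -mulrA ler_pM2l//; apply: (le_trans V); exact: lerD.
by field; rewrite gt_eqF.
Qed.
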